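(* Let $S_1,S_2\subset\mathbb{N}$ be infinite sets, let $t_1(m),t_2(m)\in\mathbb{Z}_{>0}$ for $m\in S_1$ and $t_3(m)\in\mathbb{Z}_{>0}$ for $m\in S_2$, and consider the power series $$f_1(X)=\sum_{m\in S_1}t_1(m)X^m,\quad f_2(X)=\sum_{m\in S_1}t_2(m)X^m,\quad f_3(X)=\sum_{m\in S_2}t_3(m)X^m$$ in $\mathbb{Z}[[X]]\setminus\mathbb{Z}[X]$. Put $t_1(m)=t_2(m)=0$ for $m\in\mathbb{N}\setminus S_1$ and $t_3(m)=0$ for $m\in\mathbb{N}\setminus S_2$. Assume the following conditions. (1) There exists a constant $C_1>1$ such that, for all sufficiently large $R$, $[R,C_1R)\cap S_2\neq\emptyset$. (2) For every positive real number $\varepsilon$ and $j=1,2$, $\lambda(S_j;R)=o(R^{\varepsilon})$ as $R\to\infty$. (3) For any nonnegative integers $a_1,a_2$, there exists a positive constant $C_2=C_2(a_1,a_2)$, depending only on $a_1,a_2$, such that for all $R\geq C_2$, $$R-\theta((1+a_1)S_1;R)<\frac{R}{\lambda(S_1;R)^{a_1}\lambda(S_2;R)^{a_2}}.$$ (4) There exists a constant $C_3$ with $0<C_3<1$ such that, for each $i=1,2,3$, $\log^{+}t_i(n)=o(n^{1-C_3})$ as $n\to\infty$. (5) $\displaystyle\lim_{n\to\infty,\ n\in S_1}\frac{t_1(n)}{t_2(n)}=\infty$. Then, for every Pisot or Salem number $\beta$, the three values $f_1(\beta^{-1}),f_2(\beta^{-1}),f_3(\beta^{-1})$ are algebraically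 independent.
   Context: $\mathbb{N}$ is the set of nonnegative integers, $\mathbb{Z}_{>0}$ the set of positive integers, and $\log^{+}x=\log\max\{1,x\}$. For a nonempty $\mathcal{A}\subset\mathbb{N}$ and a nonnegative real number $R$, $\lambda(\mathcal{A};R)=\operatorname{Card}([0,R)\cap\mathcal{A})$; if $R>\min\mathcal{A}$, $\theta(\mathcal{A};R)=\max([0,R)\cap\mathcal{A})$. For nonempty $\mathcal{A},\mathcal{B}\subset\mathbb{N}$, $\mathcal{A}+\mathcal{B}=\{a+b\mid a\in\mathcal{A},b\in\mathcal{B}\}$; for a positive integer $k$, $k\mathcal{A}=\mathcal{A}+\cdots+\mathcal{A}$ ($k$ summands), and $0\mathcal{A}=\{0\}$. In condition (3), $R$ ranges over real numbers, and $C_2$ is understood to be such that the quantities appearing are defined for $R\ge C_2$. A Pisot number is an algebraic integer greater than $1$ whose conjugates other than itself all have absolute value less than $1$; a Salem number is an algebraic integer greater than $1$ whose conjugates other than itself all have absolute value at most $1$, with at least one of absolute value $1$. Algebraic independence is over $\mathbb{Q}$. *)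

(* Defs.v *)
From HB Require Import structures.
From mathcomp Require Import all_boot all_order all_algebra.
From mathcomp Require Import finmap.
From mathcomp Require Import all_classical all_reals all_analysis.
From mathcomp Require Import complex.
(* Only the canonical instances of mpoly are imported: its notations clash with
   those of MathComp-Analysis. *)
From mathcomp Require mpoly.
Import (canonicals) mpoly.

Set Implicit Arguments.
Unset Strict Implicit.
Unset Printing Implicit Defensive.

Import Order.TTheory GRing.Theory Num.Theory.
Import numFieldNormedType.Exports.

Local Open Scope classical_set_scope.
Local Open Scope ring_scope.

(* The library provides this instance for \oo only; it is what the notation
   f =o_F g expects of the filter F. *)
Canonical pinfty_filter_on (R : realType) : filter_on R :=
  FilterType (pinfty_nbhs R) _.

(* [0, r) /\ A *)
Definition below (R : realType) (A : set nat) (r : R) : set nat :=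
  A `&` [set n | n%:R < r].

(* [below A r] is always finite, so [fset_set] does not take its default
   value here. *)
Definition lambda (R : realType) (A : set nat) (r : R) : nat :=
  #|` fset_set (below A r)|%N.

(* The value is 0 when [below A r] is empty; statements using [theta] must
   require [below A r !=set0]. *)
Definition theta (R : realType) (A : set nat) (r : R) : nat :=
  (\max_(n <- fset_set (below A r)) n)%N.

Definition sumset (A B : set nat) : set nat :=
  [set (a + b)%N | a in A & b in B].

Definition nfold_sumset (k : nat) (A : set nat) : set nat :=
  iterop k sumset A [set 0%N].

Definition logplus (R : realType) (x : R) : R := ln (Num.max 1 x).

Definition psum_value (R : realType) (t : nat -> nat) (x : R) : R :=
  limn (pseries (fun m => (t m)%:R) x).

Definition is_min_poly (R : realType) (x : R) (p : {poly rat}) : Prop :=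
  [/\ p \is monic, irreducible_poly p & root (map_poly ratr p) x].

Definition is_conjugate (R : realType) (x : R) (z : R[i]) : Prop :=
  exists2 p : {poly rat}, is_min_poly x p & root (map_poly ratr p) z.

Definition algebraic_integer (R : realType) (x : R) : Prop :=
  integralOver (intr : int -> R) x.

(* For z : R[i] the modulus `|z| is itself a (real) element of R[i]. *)
Definition pisot (R : realType) (b : R) : Prop :=
  [/\ algebraic_integer b, 1 < b &
      forall z : R[i], is_conjugate b z -> z != b%:C%C -> `|z| < 1].

Definition salem (R : realType) (b : R) : Prop :=
  [/\ algebraic_integer b, 1 < b,
      forall z : R[i], is_conjugate b z -> z != b%:C%C -> `|z| <= 1 &
      exists z : R[i],
        [/\ is_conjugate b z, z != b%:C%C & `|z| = 1]].

Definition alg_independent (R : realType) (n : nat) (x : 'I_n -> R) : Prop :=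
  forall p : mpoly.mpoly n rat,
    p != 0 -> mpoly.meval x (mpoly.map_mpoly ratr p) != 0.

(* Main.v *)
(** Suppose an integer combination of monomials in the three values vanishes, and
    let [c n] be the coefficients of the corresponding combination of power series.
    For every [N], the partial sum of [c n * b ^ (N - n)] over [n < N] lies in
    [Z[b]], and its conjugates are subexponential in [N] because [b] is a Pisot or
    Salem number. If [c] vanishes on an interval [[N, N + h)] with
    [h >= N ^ (1 - 1 / k)], the partial sum is minus a tail, hence exponentially
    small in [h]; being an algebraic integer of norm less than [1], it is zero.

    Order the monomials by the joint degree in the first two values, then by the
    degree in the third, then by the degree in the first. The exponents occurring
    in monomials of lower joint degree are sparse enough to leave long gaps, and
    condition (3) places a sum of elements of [S1] of the leading length well inside such a gap.
    Starting from there, the pigeonhole principle yields a gap of the sums with too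
    few elements of [S2] whose left end is such a sum, and adding an element of
    [S2] supplied by condition (1) gives an exponent of the leading monomial in
    the middle of the gap. In this window only monomials of leading degrees
    contribute, with large indices in [S1], so by condition (5) all coefficients
    there are nonnegative (up to a global sign) and the one in the middle is
    positive. On both sides of it the support of [c] leaves gaps long enough for
    the partial sums to vanish, which is a contradiction. *)

Require Import Defs.
From HB Require Import structures.
From mathcomp Require Import all_boot all_order all_algebra.
From mathcomp Require Import all_classical all_reals all_analysis.
From mathcomp Require Import finmap complex zify ring lra.
From mathcomp Require mpoly.
Import (canonicals, coercions) mpoly.

Set Implicit Arguments.
Unset Strict Implicit.
Unset Printing Implicit Defensive.

Import Order.TTheory GRing.Theory Num.Theory.
Import numFieldNormedType.Exports.

Local Open Scope classical_set_scope.
Local Open Scope ring_scope.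

(** * The norm of an element of Z[b] *)

Lemma horner_char_poly (K : comNzRingType) n (A : 'M[K]_n) w :
  (char_poly A).[w] = \det (w%:M - A).
Proof.
rewrite -horner_evalE -det_map_mx; congr (\det _).
apply/matrixP => i j; rewrite !mxE /= /horner_eval hornerD hornerN hornerC hornerMn hornerX.
by [].
Qed.

(** Over a closed field [q] splits, and multiplicativity leaves the linear factors: the determinant
    of [A - w] is the characteristic polynomial at [w] up to a sign that both sides share. For a
    companion matrix this product is the norm of [q] at a root. *)
Lemma det_horner_mx (K : closedFieldType) n (A : 'M[K]_n.+1) (q : {poly K}) rs :
  char_poly A = \prod_(z <- rs) ('X - z%:P) ->
  \det (horner_mx A q) = \prod_(z <- rs) q.[z].
Proof.
move=> Ars; have srs : size rs = n.+1.
  by have := size_char_poly A; rewrite Ars size_prod_XsubC => -[].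
have [ws ->] := closed_field_poly_normal q.
elim: ws (lead_coef q) => [c|w ws IH c].
  rewrite big_nil alg_polyC horner_mx_C det_scalar -srs.
  under eq_bigr do rewrite hornerC.
  by rewrite big_const_seq count_predT iter_mulr_1.
rewrite big_cons scalerAr rmorphM detM IH.
under [in RHS]eq_bigr do rewrite hornerM.
rewrite big_split /=; congr (_ * _).
rewrite rmorphB /= horner_mx_X horner_mx_C -opprB -scaleN1r detZ.
rewrite -horner_char_poly Ars horner_prod.
under eq_bigr do rewrite hornerXsubC.
under [in RHS]eq_bigr do rewrite hornerXsubC -opprB -mulN1r.
by rewrite big_split big_const_seq count_predT iter_mulr_1 srs.
Qed.

(** Gauss's lemma: an integer polynomial proportional to [p] divides [P] over the integers, so its
    leading coefficient divides 1 and only a sign remains to be corrected. *)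
Lemma monic_rat_factor_int (p : {poly rat}) (P : {poly int}) :
  p \is monic -> P \is monic -> p %| map_poly intr P ->
  exists2 p1 : {poly int}, p1 \is monic & p = map_poly intr p1.
Proof.
move=> pm Pm /dvdpP_rat_int [p1 [a a0 pE] [r Pr]].
have /(congr1 lead_coef) := Pr; rewrite (monicP Pm) lead_coefM => /esym l1.
have lu : lead_coef p1 \is a GRing.unit by apply/unitrPr; exists (lead_coef r).
have lsq : lead_coef p1 * lead_coef p1 = 1.
  by move: lu => /orP[] /eqP ->.
have la : a * (lead_coef p1)%:~R = 1.
  have := monicP pm; rewrite {1}pE lead_coefZ lead_coef_map_inj //.
  exact: intr_inj.
have aE : a = (lead_coef p1)%:~R.
  have lq : (lead_coef p1)%:~R * (lead_coef p1)%:~R = 1 :> rat.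
    by rewrite -intrM lsq.
  by rewrite -[LHS]mulr1 -[X in _ * X]lq mulrA la mul1r.
exists (lead_coef p1 *: p1).
  by rewrite monicE lead_coefZ lsq.
by rewrite map_polyZ pE aE.
Qed.

(** A rational polynomial of least size vanishing at [b] divides every other one, as the remainder
    would be smaller; a proper factor vanishing at [b] would contradict this. *)
Lemma exists_min_poly (R : realType) (b : R) (P : {poly int}) :
  P \is monic -> root (map_poly intr P) b ->
  exists2 p : {poly rat}, is_min_poly b p & p %| map_poly intr P.
Proof.
move=> Pm Pb.
pose I n := `[< exists p : {poly rat},
  [/\ p != 0, root (map_poly ratr p) b & size p = n] >].
have ratrP (Q : {poly int}) :
    map_poly ratr (map_poly intr Q) = map_poly intr Q :> {poly R}.
  by rewrite -map_poly_comp; apply: eq_map_poly => x /=; rewrite ratr_int.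
have P0 : map_poly intr P != 0 :> {poly rat}.
  by rewrite monic_neq0 // monic_map.
have exI : exists n, I n.
  exists (size (map_poly intr P : {poly rat})); apply/asboolP.
  by exists (map_poly intr P); split=> //; rewrite ratrP.
case: (ex_minnP exI) => n /asboolP[q [q0 qb qn]] nmin.
have qmin r : root (map_poly ratr r) b -> q %| r.
  move=> rb; apply/modp_eq0P/eqP; apply/negPn/negP => rq0.
  have : I (size (r %% q)).
    apply/asboolP; exists (r %% q); split=> //.
    move: rb; rewrite {1}(divp_eq r q) rmorphD rmorphM /= /root hornerD hornerM.
    by rewrite (rootP qb) mulr0 add0r.
  by move=> /nmin; rewrite -qn leqNgt ltn_modp q0.
exists ((lead_coef q)^-1 *: q); last first.
  by rewrite dvdpZl ?invr_eq0 ?lead_coef_eq0 // qmin // ratrP.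
have l0 : (lead_coef q)^-1 != 0 by rewrite invr_eq0 lead_coef_eq0.
split.
- by rewrite monicE lead_coefZ mulVf // lead_coef_eq0.
- split.
    rewrite size_scale //; rewrite ltnNge; apply/negP => /size1_polyC qC.
    by move: q0 qb; rewrite qC map_polyC /= rootC !fmorph_eq0 => /negP q00 /q00.
  move=> r r1; rewrite dvdpZr // => rq.
  apply: (@eqp_trans _ q); last by rewrite eqp_sym eqp_scale.
  have [s qE] := dvdpP _ _ rq.
  have s0 : s != 0 by apply: contraNneq q0; rewrite qE => ->; rewrite mul0r.
  have r0 : r != 0 by apply: contraNneq q0; rewrite qE => ->; rewrite mulr0.
  have : root (map_poly ratr s) b || root (map_poly ratr r) b.
    by rewrite -rootM -rmorphM -qE.
  case/orP => [/qmin|/qmin qr]; last by rewrite /eqp rq qr.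
  move=> /(dvdp_leq s0); rewrite qE size_mul // => ss.
  rewrite -size_poly_gt0 in s0; rewrite -size_poly_gt0 in r0.
  case/eqP: r1; apply/eqP; rewrite eqn_leq r0 andbT.
  by move: ss s0; case: (size s) => // u; rewrite addSn /= -{2}[u]addn0 -addnS leq_add2l.
- by rewrite map_polyZ rootZ ?fmorph_eq0.
Qed.

Lemma ler_norm_horner (K : numDomainType) (q : {poly int}) (z : K) :
  `|z| <= 1 -> `|(map_poly intr q).[z]| <= (\sum_(i < size q) `|q`_i|)%:~R.
Proof.
move=> z1; rewrite horner_coef size_map_inj_poly //; last exact: intr_inj.
rewrite (rmorph_sum intr) /=.
apply: le_trans (ler_norm_sum _ _ _) _; apply: ler_sum => i _.
rewrite coef_map /= normrM normrX -intr_norm -[leRHS]mulr1 ler_wpM2l //.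
by rewrite exprn_ile1.
Qed.

(* The product of the conjugates of [q.[b]] is a nonzero integer. *)
Lemma norm_lower_bound (R : realType) (b : R) : pisot b \/ salem b ->
  exists d : nat, forall q : {poly int}, (map_poly intr q).[b] != 0 ->
    1 <= `|(map_poly intr q).[b]| * (\sum_(i < size q) `|q`_i|)%:~R ^+ d.
Proof.
move=> Hb.
have [P Pm Pb] : algebraic_integer b by case: Hb => -[].
have bc (z : R[i]) : is_conjugate b z -> z != b%:C%C -> `|z| <= 1.
  by case: Hb => -[_ _ H] *; [apply/ltW/H | apply: H].
have [p pmin pP] := exists_min_poly Pm Pb.
have [pm pirr pb] := pmin.
have [p1 p1m pE] := monic_rat_factor_int pm Pm pP.
pose p2 : {poly R[i]} := map_poly ratr p.
have p2E : p2 = map_poly intr p1.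
  by rewrite /p2 pE -map_poly_comp; apply: eq_map_poly => x /=; rewrite ratr_int.
have p2m : p2 \is monic by rewrite monic_map.
have [rs p2rs] := closed_field_poly_normal p2.
rewrite (monicP p2m) scale1r in p2rs.
have [n sn] : exists n, size p1 = n.+2.
  case: pirr => + _; rewrite pE size_map_inj_poly //; last exact: intr_inj.
  by case: (size p1) => [|[|n]] // _; exists n.
(* An integer companion matrix turns the product over the conjugates into an integer determinant. *)
have [A AE] : exists A : 'M[int]_n.+1, char_poly A = p1.
  have := companionmxK p1m; move: (companionmx p1); rewrite sn /= => A AE.
  by exists A.
exists (size rs) => q qb.
pose qC : {poly R[i]} := map_poly intr q.
have hornerC x : qC.[x%:C%C] = ((map_poly intr q).[x])%:C%C.
  rewrite -horner_map /= -map_poly_comp; congr (_.[_]).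
  by apply: eq_map_poly => y /=; rewrite rmorph_int.
have brs : b%:C%C \in rs.
  rewrite -root_prod_XsubC -p2rs /p2.
  have -> : map_poly ratr p = map_poly (real_complex R) (map_poly ratr p).
    rewrite -map_poly_comp; apply: eq_map_poly => y /=; by rewrite fmorph_rat.
  by rewrite fmorph_root.
have ratrq (K : numFieldType) :
    map_poly intr q = map_poly ratr (map_poly intr q : {poly rat}) :> {poly K}.
  by rewrite -map_poly_comp; apply: eq_map_poly => y /=; rewrite ratr_int.
(* The irreducible [p] does not divide [q], so the two are coprime and [q] vanishes at no conjugate
   of [b]. *)
have qz z : z \in rs -> qC.[z] != 0.
  move=> zrs; have cop : coprimep p (map_poly intr q).
    rewrite irreducible_poly_coprime //; apply: contraNN qb => /dvdpP[s sE].
    by rewrite ratrq sE rmorphM hornerM (rootP pb) mulr0.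
  rewrite /qC ratrq; apply: (@coprimep_root _ p2); first by rewrite coprimep_map.
  by rewrite p2rs root_prod_XsubC.
have rsA : char_poly (map_mx (intr : int -> R[i]) A) = \prod_(z <- rs) ('X - z%:P).
  by rewrite -map_char_poly AE -p2E.
have := det_horner_mx qC rsA.
rewrite -map_horner_mx det_map_mx /=.
move: (\det _) => m mE.
have m0 : m != 0.
  have : (m%:~R : R[i]) != 0 by rewrite mE prodf_seq_neq0; apply/allP => z /qz.
  by rewrite intr_eq0.
set S := (\sum_(i < size q) _)%:~R.
have S1 : 1 <= S.
  rewrite /S -[1]/(1%:~R) ler_int -gtz0_ge1.
  have q0 : q != 0 by apply: contraNneq qb => ->; rewrite rmorph0 horner0.
  have sq : (0 < size q)%N by rewrite size_poly_gt0.
  have [j jE] : exists j : 'I_(size q), j = (size q).-1 :> nat.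
    by have jq : ((size q).-1 < size q)%N; [rewrite prednK|exists (Ordinal jq)].
  rewrite (bigD1 j) //= ltr_pwDl ?sumr_ge0 // normr_gt0 jE.
  by rewrite -/(lead_coef q) lead_coef_eq0.
have [|q1] := leP 1 `|(map_poly intr q).[b]|.
  by move=> H; apply: (le_trans H); rewrite ler_peMr // exprn_ege1.
suff : (1 : R[i]) <= (`|(map_poly intr q).[b]| * S ^+ size rs)%:C%C.
  by rewrite -(rmorph1 (real_complex R)) lecR.
rewrite rmorphM rmorphXn /=.
have nb : `|qC.[b%:C%C]| = `|(map_poly intr q).[b]|%:C%C by rewrite hornerC normc_def /= expr0n addr0 sqrtr_sqr.
have SC : S%:C%C = (\sum_(i < size q) `|q`_i|)%:~R by rewrite /S rmorph_int.
have le1 : 1 <= `|m%:~R : R[i]|.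
  by rewrite -intr_norm ler1z -gtz0_ge1 normr_gt0.
apply: (le_trans le1); rewrite mE normr_prod (perm_big _ (perm_to_rem brs)) /= big_cons nb.
rewrite ler_wpM2l //; first by rewrite -nb.
have S1C : 1 <= S%:C%C by rewrite -(rmorph1 (real_complex R)) lecR.
(* A repeated occurrence of [b] in [rs] is covered by [q1]; every other root lies in the closed unit
   disc. *)
have rsrs z : z \in rem b%:C%C rs -> `|qC.[z]| <= S%:C%C.
  move=> /mem_rem zrs; have [->|zb] := eqVneq z b%:C%C.
    by rewrite nb lecR (le_trans (ltW q1)).
  rewrite SC ler_norm_horner // bc //; exists p => //.
  by rewrite -/p2 p2rs root_prod_XsubC.
have : (size (rem b%:C%C rs) <= size rs)%N by rewrite size_rem // leq_pred.
elim: (rem _ _) (size rs) rsrs => [|z s IH] k /= H.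
  by rewrite big_nil exprn_ege1.
case: k => // k ks; rewrite big_cons exprS ler_pM //; first by apply: prodr_ge0.
  by apply: H; rewrite mem_head.
by apply: IH => // y ys; apply: H; rewrite in_cons ys orbT.
Qed.

(** * Windows free of shorter sums *)

Section WindowsOfSums.

Local Open Scope nat_scope.

(** These sets contain the exponents of products of at most [d] of the first two series and at most
    [j] copies of the third. Bounds on the lengths, instead of equalities, make them monotone in [d]
    and [j]. *)
Definition mixed_sums (A B : set nat) (d j : nat) : set nat :=
  [set n | exists s1 s2 : seq nat,
    [/\ (size s1 <= d)%N, (size s2 <= j)%N, {in s1, forall x, A x},
        {in s2, forall x, B x} & n = (sumn s1 + sumn s2)%N]].

(** Adjoining 0 to each list replaces at most [d] or [j] terms by exactly that many, whence the
    [.+1] in the count. Repetitions in the list are harmless, since the pigeonhole principle only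
    needs its length. *)
Lemma mixed_sums_cover (A B : set nat) (X : nat) (lA lB : seq nat) d j :
  (forall n, n < X -> A n -> n \in lA) ->
  (forall n, n < X -> B n -> n \in lB) ->
  exists2 l : seq nat, size l = (size lA).+1 ^ d * (size lB).+1 ^ j &
    forall n, n < X -> mixed_sums A B d j n -> n \in l.
Proof.
move=> HA HB.
have: exists2 l : seq nat, size l = (size lB).+1 ^ j &
    forall n, n < X -> mixed_sums A B 0 j n -> n \in l.
  elim: j => [|j [l sl Hl]].
    exists [:: 0] => // n _ [s1 [s2 []]].
    rewrite !leqn0 => /nilP -> /nilP -> _ _ ->; exact: mem_head.
  exists [seq x + y | x <- 0 :: lB, y <- l].
    by rewrite size_allpairs /= sl expnS.
  move=> n nX [s1 [s2 [h1 h2 h3 h4 nE]]]; apply/allpairsP.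
  case: s2 h2 h4 nE => [|b s2] h2 h4 nE.
    exists (0, n); split=> //=.
    by apply: Hl => //; exists s1, [::].
  move: nE => /= nE; exists (b, sumn s1 + sumn s2); split=> /=; last by lia.
    rewrite in_cons HB ?orbT //; first lia.
    by apply: h4; rewrite mem_head.
  apply: Hl; first lia.
  by exists s1, s2; split=> // x xs; apply: h4; rewrite in_cons xs orbT.
case=> l0 sl0 Hl0; elim: d => [|d [l sl Hl]].
  by exists l0; rewrite ?mul1n.
exists [seq x + y | x <- 0 :: lA, y <- l].
  by rewrite size_allpairs /= sl expnS mulnA.
move=> n nX [s1 [s2 [h1 h2 h3 h4 nE]]]; apply/allpairsP.
case: s1 h1 h3 nE => [|b s1] h1 h3 nE.
  exists (0, n); split=> //=.
  by apply: Hl => //; exists [::], s2.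
move: nE => /= nE; exists (b, sumn s1 + sumn s2); split=> /=; last by lia.
  rewrite in_cons HA ?orbT //; first lia.
  by apply: h3; rewrite mem_head.
apply: Hl; first lia.
by exists s1, s2; split=> // x xs; apply: h3; rewrite in_cons xs orbT.
Qed.

(** Pigeonhole: when the first block of length [g] meets [l], moving to the next block discards at
    least one element of [l], so at most [size l] blocks are skipped. *)
Lemma gap_exists (l : seq nat) (a w g : nat) : g * (size l).+1 <= w ->
  exists x, [/\ a <= x, x + g <= a + w &
    forall n, x <= n < x + g -> n \notin l].
Proof.
have [k] := ubnP (size l); elim: k l a w => // k IH l a w.
rewrite ltnS => lk gw.
case: (boolP (has (fun n => a <= n < a + g) l)) => [/hasP[y yl ya]|/hasPn H].
  pose l' := [seq n <- l | a + g <= n].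
  have sl' : size l' < size l.
    rewrite size_filter -(count_predC (fun n => a + g <= n) l) -addn1 leq_add2l.
    by rewrite -has_count; apply/hasP; exists y => //=; lia.
  have [||x [x1 x2 x3]] := IH l' (a + g) (w - g); [lia|nia|].
  exists x; split; [lia|nia|] => n nx.
  have := x3 n nx; rewrite mem_filter negb_and.
  by case/orP => //; lia.
exists a; split=> //; first nia.
by move=> n na; apply/negP => /H; rewrite na.
Qed.

Lemma mixed_sumsS A B d j d' j' : d <= d' -> j <= j' ->
  mixed_sums A B d j `<=` mixed_sums A B d' j'.
Proof.
move=> dd jj n [s1 [s2 [h1 h2 h3 h4 h5]]]; exists s1, s2; split=> //.
  exact: leq_trans dd.
exact: leq_trans jj.
Qed.

Lemma leq_divn2 (a b : nat) : 0 < b <= a -> a <= 2 * b * (a %/ b).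
Proof.
case/andP=> b0 ba; have := ltn_ceil a b0.
have : 0 < a %/ b by rewrite divn_gt0.
nia.
Qed.

(* [f N = o(N ^ eps)] for every [eps > 0], stated without real exponents. *)
Definition eventually_le (f : nat -> nat) :=
  forall K, exists N0, forall N, N0 <= N -> f N ^ K <= N.

Lemma leq_expn (m a b : nat) : a <= b -> a ^ m <= b ^ m.
Proof. by case: m => // m ab; rewrite leq_exp2r. Qed.

(** Otherwise each doubling of the argument multiplies [f] by more than 4, so [f] grows at least
    quadratically along [2 ^ i * m], against [f N <= N]. This provides scales at which counts up to
    [N] and up to [2 * N] are comparable. *)
Lemma doubling (f : nat -> nat) (N0 : nat) :
  eventually_le f -> (forall N, N0 <= N -> 0 < f N) ->
  exists2 N, N0 <= N & f (2 * N) <= 4 * f N.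
Proof.
move=> fle f0; apply: contrapT => H.
have {}H N : N0 <= N -> 4 * f N < f (2 * N).
  by move=> NN; rewrite ltnNge; apply/negP => HN; apply: H; exists N.
have [N1 HN1] := fle 1%N.
pose m := (maxn N0 N1).+1.
have grow i : 4 ^ i <= f (2 ^ i * m).
  elim: i => [|i IH]; first by rewrite mul1n f0 // /m; lia.
  have i0 : 0 < 2 ^ i by rewrite expn_gt0.
  have := H (2 ^ i * m); rewrite !expnS -mulnA => Hi.
  have : N0 <= 2 ^ i * m by rewrite /m; nia.
  by move=> /Hi; lia.
have bnd i : 4 ^ i <= 2 ^ i * m.
  apply: (leq_trans (grow i)); have := HN1 (2 ^ i * m); rewrite expn1; apply.
  have i0 : 0 < 2 ^ i by rewrite expn_gt0.
  by rewrite /m; nia.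
have := bnd m; have -> : 4 ^ m = 2 ^ m * 2 ^ m by rewrite -expnMn.
rewrite leq_pmul2l ?expn_gt0 //; have := ltn_expl m (isT : 1 < 2); lia.
Qed.

Lemma eventually_le_mul (f g : nat -> nat) :
  eventually_le f -> eventually_le g -> eventually_le (fun N => f N * g N).
Proof.
move=> fle gle K; have [Nf Hf] := fle (2 * K); have [Ng Hg] := gle (2 * K).
exists (maxn Nf Ng) => N; rewrite geq_max => /andP[/Hf + /Hg].
move=> H1 H2; rewrite -(@leq_exp2r _ _ 2) // -expnM [K * 2]mulnC expnMn -mulnn.
exact: leq_mul.
Qed.

Lemma eventually_le_double (f : nat -> nat) :
  eventually_le f -> eventually_le (fun N => f (2 * N)).
Proof.
move=> fle K; have [N0 H] := fle (2 * K); exists (maxn N0 4) => N.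
rewrite geq_max => /andP[N0N N4]; rewrite -(@leq_exp2r _ _ 2) // -expnM [K * 2]mulnC.
by apply: (leq_trans (H (2 * N) _)); nia.
Qed.

Definition counted (S : set nat) (l : nat -> nat) :=
  forall N, exists2 s : seq nat, size s = l N & forall n, n < N -> S n -> n \in s.

Lemma cover_size (a b d j : nat) : 1 < a -> 1 < b ->
  (a.+1 ^ d * b.+1 ^ j).+1 <= (a * b) ^ (2 * (d + j) + 1).
Proof.
move=> a1 b1; have z2 : 1 < a * b by nia.
apply: (@leq_ltn_trans ((a * b) ^ (2 * (d + j)))); last by rewrite ltn_exp2l; lia.
rewrite mulnDr expnD !expnM.
by apply: leq_mul; apply: leq_expn; rewrite -mulnn; nia.
Qed.

(** The sums to be avoided number at most a constant times [lA N ^ d * lB N ^ L], which leaves a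
    gap. Condition (3) with exponents [d] and [L.+1], aimed at the midpoint of the gap, gives a sum
    closer to it than half the gap once [lB N] beats the constants; the right half of the gap is
    then kept. *)
Lemma gap_after_sum (A B : set nat) (lA lB : nat -> nat) (d L N : nat) :
  counted A lA -> counted B lB -> {homo lA : x y / x <= y} ->
  {homo lB : x y / x <= y} ->
  (forall r, N <= r -> exists s : seq nat, [/\ size s = d.+1,
     {in s, forall x, A x}, sumn s < r &
     (r - sumn s) * (lA r ^ d * lB r ^ L.+1) < r]) ->
  lA (2 * N) * lB (2 * N) <= 4 * (lA N * lB N) ->
  1 < lA N -> 32 * 8 ^ (d + L) <= lB N ->
  4 * (lA (2 * N) * lB (2 * N)) ^ (2 * (d + L) + 1) <= N ->
  exists2 s : seq nat, [/\ size s = d.+1, {in s, forall x, A x} & N <= sumn s] &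
  exists w, [/\ sumn s + w <= 2 * N,
    N <= 16 * (lA (2 * N) * lB (2 * N)) ^ (2 * (d + L) + 1) * w &
    forall n, sumn s <= n < sumn s + w -> ~ mixed_sums A B d L n].
Proof.
move=> cA cB mA mB c3 dbl lA1 lBN bigN.
have lA0 := ltnW lA1.
have [sA sAE HsA] := cA (2 * N); have [sB sBE HsB] := cB (2 * N).
have [l sl Hl] := mixed_sums_cover d L HsA HsB.
have lA2 : lA N <= lA (2 * N) by apply: mA; lia.
have lB2 : lB N <= lB (2 * N) by apply: mB; lia.
have lB0 : 1 < lB N.
  by apply: leq_trans lBN; have := expn_gt0 8 (d + L); lia.
(* Both counts are monotone, so the bound on their product limits the growth of each one to a factor
   4. *)
have lA4 : lA (2 * N) <= 4 * lA N.
  rewrite -(@leq_pmul2r (lB N)) ?(ltnW lB0) // -mulnA.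
  by apply: leq_trans dbl; rewrite leq_mul2l lB2 orbT.
have lB4 : lB (2 * N) <= 4 * lB N.
  rewrite -(@leq_pmul2l (lA N)) // mulnCA.
  by apply: leq_trans dbl; rewrite leq_mul2r lA2 orbT.
set P := lA N ^ d * lB N ^ L.
(* The base 8 is 2 * 4: the 2 absorbs the [.+1] and the 4 the passage from [2 * N] to [N]. *)
have slP : size l <= 8 ^ (d + L) * P.
  rewrite sl sAE sBE expnD /P mulnACA -!expnMn.
  by apply: leq_mul; apply: leq_expn; lia.
set z := (lA (2 * N) * lB (2 * N)) in bigN *.
have slz : (size l).+1 <= z ^ (2 * (d + L) + 1).
  by rewrite sl sAE sBE; apply: cover_size; [exact: leq_trans lA2|exact: leq_trans lB2].
pose w := N %/ (size l).+1.
have [x [x1 x2 x3]] := @gap_exists l N N w (leq_trunc_div _ _).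
have [s [s1 s2 s3 s4]] := c3 (x + w./2) (leq_trans x1 (leq_addr _ _)).
have wN : N <= 2 * (size l).+1 * w by apply: leq_divn2; lia.
have w4 : 4 <= w.
  by rewrite leq_divRL //; apply: leq_trans bigN; rewrite leq_mul2l slz orbT.
have w24 : w <= 4 * w./2 by lia.
(* If the sum fell short of [x], its distance to the midpoint would exceed [w./2], giving
   [w./2 * P * lB N < 2 * N]. Together with [wN] this contradicts [lBN]. *)
have xs : x <= sumn s.
  rewrite leqNgt; apply/negP => sx.
  have P0 : 0 < P by rewrite muln_gt0 !expn_gt0; lia.
  have PP : P * lB N <= lA (x + w./2) ^ d * lB (x + w./2) ^ L.+1.
    rewrite /P -mulnA -expnSr; apply: leq_mul; apply: leq_expn;
    by [apply: mA; lia|apply: mB; lia].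
  have q0 : 0 < 8 ^ (d + L) by rewrite expn_gt0.
  have PN : (w./2 * P) * lB N < 2 * N.
    rewrite -mulnA; apply: leq_ltn_trans (leq_trans s4 _); last lia.
    by apply: leq_mul => //; lia.
  have Nw : N <= 16 * (8 ^ (d + L) * (w./2 * P)).
    apply: (leq_trans wN); apply: (@leq_trans (2 * (2 * (8 ^ (d + L) * P)) * (4 * w./2))).
      apply: leq_mul; last exact: w24.
      have : 0 < 8 ^ (d + L) * P by rewrite muln_gt0 q0.
      by rewrite leq_pmul2l //; move: slP; clear; lia.
    lia.
  move: (w./2 * P) (8 ^ (d + L)) Nw PN lBN => u v Nw PN lBN.
  by have := leq_mul (leqnn u) lBN; clear -Nw PN; lia.
exists s; first by split=> //; lia.
exists w./2; split; [lia| |].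
  have := leq_mul slz w24; lia.
by move=> n ns /Hl Hn; have /negP[] := x3 n ltac:(lia); apply: Hn; lia.
Qed.

Definition unbounded (f : nat -> nat) :=
  forall K, exists N0, forall N, N0 <= N -> K <= f N.

(* [Y] exceeds the number of sums below [2 * N] in each of the three applications
   of the pigeonhole principle, each of which shrinks the gap by a factor [2 * Y]
   at most. *)
Lemma window_in_scale (A B : set nat) (lA lB : nat -> nat) (d e L K M N N1 : nat) :
  counted A lA -> counted B lB -> {homo lA : x y / x <= y} ->
  {homo lB : x y / x <= y} ->
  (forall r, N <= r -> exists s : seq nat, [/\ size s = d.+1,
     {in s, forall x, A x}, sumn s < r &
     (r - sumn s) * (lA r ^ d * lB r ^ L.+1) < r]) ->
  0 < K -> (forall r, N1 <= r -> exists2 l, B l & r <= l < K * r) ->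
  lA (2 * N) * lB (2 * N) <= 4 * (lA N * lB N) ->
  1 < lA N -> 32 * 8 ^ (d + L) <= lB N -> e < L -> forall Y, Y = (lA (2 * N) * lB (2 * N)) ^ (2 * (d.+1 + L) + 1) ->
  256 * K * (M + N1 + 1) * Y ^ 3 <= N ->
  exists a m b x y g : nat,
   [/\ [/\ N <= a, b <= 2 * N & N <= 512 * K * Y ^ 3 * g],
       [/\ a + M < x, x + g <= m, m < y & y + g <= b],
       forall n, a < n < b -> ~ mixed_sums A B d L n /\ ~ mixed_sums A B d.+1 e n,
       forall n, x <= n < x + g \/ y <= n < y + g -> ~ mixed_sums A B d.+1 L n &
       exists s1 s2, [/\ size s1 = d.+1, size s2 = e.+1,
         {in s1, forall x, A x}, {in s2, forall x, B x} & m = sumn s1 + sumn s2] ].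
Proof.
move=> cA cB mA mB c3 K0 c1 dbl lA1 lBN eL Y YZ bigN.
have lA2 : lA N <= lA (2 * N) by apply: mA; lia.
have lB2 : lB N <= lB (2 * N) by apply: mB; lia.
have lB1 : 1 < lB N.
  by apply: leq_trans lBN; have := expn_gt0 8 (d + L); lia.
have lA21 := leq_trans lA1 lA2; have lB21 := leq_trans lB1 lB2.
have z1 : 1 < lA (2 * N) * lB (2 * N) by move: lA21 lB21; clear; nia.
have expY i : i <= 2 * (d.+1 + L) + 1 -> (lA (2 * N) * lB (2 * N)) ^ i <= Y.
  by move=> iY; rewrite YZ leq_exp2l.
have Y0 : 0 < Y by rewrite YZ expn_gt0 (ltnW z1).
have [sA sAE HsA] := cA (2 * N); have [sB sBE HsB] := cB (2 * N).
have [l2 sl2 Hl2] := mixed_sums_cover d.+1 e HsA HsB.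
have [l3 sl3 Hl3] := mixed_sums_cover d.+1 L HsA HsB.
rewrite sAE sBE in sl2 sl3.
have sl2Y : (size l2).+1 <= Y.
  by rewrite sl2; apply: leq_trans (cover_size _ _ _ _) (expY _ _) => //; lia.
have sl3Y : (size l3).+1 <= Y.
  by rewrite sl3; apply: leq_trans (cover_size _ _ _ _) (expY _ _) => //; lia.
have YE : Y ^ 3 = Y * (Y * Y) by rewrite !expnS expn0 muln1.
(* First pigeonhole: a stretch of length [w] from [sumn s] on, free of sums of at most [d] elements
   of [A] and [L] of [B]. *)
have [|s [s1 s2 s3] [w [w1 w2 w3]]] := gap_after_sum cA cB mA mB c3 dbl lA1 lBN.
  apply: (leq_trans (leq_mul (leqnn 4) (expY _ _))); first lia.
  apply: leq_trans bigN; rewrite YE -[256 * K * _]mulnA.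
  have c0 : 0 < K * (M + N1 + 1) by rewrite muln_gt0 K0; lia.
  have := @leq_pmulr Y (Y * Y * (K * (M + N1 + 1))); rewrite muln_gt0 c0 muln_gt0 Y0 => /(_ isT).
  by move: (K * _) => c; lia.
have {}w2 : N <= 16 * Y * w.
  by apply: (leq_trans w2); rewrite leq_mul2r leq_mul2l expY ?orbT //; lia.
have YN : 256 * (K * (M + N1 + 1)) * (Y * (Y * Y)) <= N by rewrite -YE mulnA.
have K1 : 0 < K * (M + N1 + 1) by rewrite muln_gt0 K0; lia.
have wY : Y <= w.
  have : 16 * Y * Y <= 16 * Y * w.
    apply: leq_trans w2; apply: leq_trans YN; move: (K * _) K1 => c c0.
    have := @leq_pmulr (Y * Y) (Y * c); rewrite muln_gt0 Y0 c0 => /(_ isT); lia.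
  by rewrite leq_pmul2l // muln_gt0.
(* [g0] is the gap length of the second pigeonhole, applied to [l2] inside this stretch. *)
have [g0 wg0 g0Y] : exists2 g0, w <= 2 * Y * g0 & g0 * Y <= w.
  by exists (w %/ Y); [apply: leq_divn2; rewrite Y0|apply: leq_trunc_div].
have Ng0 : N <= 32 * (Y * Y) * g0.
  apply: (leq_trans w2); apply: leq_trans (leq_mul (leqnn (16 * Y)) wg0) _; lia.
have Kg0 : 8 * (K * (M + N1 + 1)) <= g0.
  have : 32 * (Y * Y) * (8 * (K * (M + N1 + 1))) <= 32 * (Y * Y) * g0.
    apply: leq_trans Ng0; apply: leq_trans YN; move: (K * _) => c.
    have := @leq_pmulr (Y * Y * c) Y Y0; lia.
  by rewrite leq_pmul2l // !muln_gt0 Y0.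
(* An element of [B] in [[r, K * r)] is less than half of [g0], so adding it to the left end of the
   gap leaves room on both sides. *)
have [r g0r rK] : exists2 r, g0 <= 4 * K * r & r * (2 * K) <= g0.
  exists (g0 %/ (2 * K)); last exact: leq_trunc_div.
  have := @leq_divn2 g0 (2 * K); rewrite mulnA; apply; rewrite muln_gt0 K0 /=.
  apply: leq_trans Kg0; have : K <= K * (M + N1 + 1) by rewrite leq_pmulr // addn1.
  by clear; lia.
have rM : 2 * (M + N1 + 1) <= r.
  have : 4 * K * (2 * (M + N1 + 1)) <= 4 * K * r by apply: leq_trans g0r; apply: leq_trans Kg0; lia.
  by rewrite leq_pmul2l // muln_gt0.
(* [h] is what is left of [r] after a margin of [M + 1] is set aside. *)
have [h rh hr] : exists2 h, r <= 2 * h & h + (M + 1) <= r.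
  by exists (r - (M + 1)); move: rM; clear; lia.
have g0h : g0 <= 8 * K * h by apply: (leq_trans g0r); move: rh; clear; nia.
have Nh : N <= 256 * K * (Y * Y) * h.
  apply: (leq_trans Ng0); apply: leq_trans (leq_mul (leqnn _) g0h) _; lia.
have hY : Y <= h.
  have : 256 * K * (Y * Y) * Y <= 256 * K * (Y * Y) * h.
    apply: leq_trans Nh; apply: leq_trans YN.
    have := @leq_pmulr (K * (Y * (Y * Y))) (M + N1 + 1); rewrite addn1 => /(_ isT); clear; lia.
  by rewrite leq_pmul2l // !muln_gt0 Y0 K0.
(* [g] is the gap length of the third pigeonhole, applied to [l3] on each side of the middle. *)
have [g hg gYh] : exists2 g, h <= 2 * Y * g & g * Y <= h.
  by exists (h %/ Y); [apply: leq_divn2; rewrite Y0|apply: leq_trunc_div].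
have Ng : N <= 512 * K * Y ^ 3 * g.
  apply: (leq_trans Nh); apply: leq_trans (leq_mul (leqnn _) hg) _; rewrite YE; clear; lia.
have [|x [x1 x2 x3]] := @gap_exists l2 (sumn s) w g0.
  by apply: leq_trans (leq_mul (leqnn _) sl2Y) _.
have g00 : 0 < g0 by move: Kg0 K1; clear; lia.
clear YZ bigN YN w2 wg0 Ng0 Kg0 g0r g0h Nh hg dbl lBN z1 YE hY K1 sAE sBE lA1 lB1 lA2 lB2 lA21 lB21.
(* The window starts at [a], the last sum of at most [d.+1] elements of [A] and [e] of [B] up to
   [x]. As [sumn s] is such a sum, [a] lies in the first stretch; between [a] and [x + g0] no
   further one occurs. *)
pose I n := `[< mixed_sums A B d.+1 e n >] && (n <= x).
have exI : exists n, I n.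
  exists (sumn s); rewrite /I x1 andbT; apply/asboolP; exists s, [::].
  by split; rewrite ?s1 ?addn0.
have Ix n : I n -> n <= x by case/andP.
have [a /andP[/asboolP aG ax] amax] := ex_maxnP exI Ix.
have sa : sumn s <= a by apply: amax; rewrite /I x1 andbT; apply/asboolP;
  exists s, [::]; split; rewrite ?s1 ?addn0.
have gapa n : a < n < x + g0 ->
    ~ mixed_sums A B d L n /\ ~ mixed_sums A B d.+1 e n.
  move=> na; split; first by apply: w3; lia.
  move=> nG; have [nx|xn] := leqP n x.
    by have : n <= a; [apply: amax; rewrite /I nx andbT; apply/asboolP|lia].
  have /negP[] : n \notin l2 by apply: x3; lia.
  by apply: Hl2 => //; lia.
(* Condition (1) supplies [l], and [a + l] becomes the middle of the window. *)
have [l Bl /andP[rl lK]] := c1 r ltac:(lia).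
have lK2 : 2 * l < g0 by move: lK rK; clear; nia.
have m2 : a < a + l < x + g0 by lia.
have [|x' [y1 y2 y3]] := @gap_exists l3 (a + M + 1) (a + l - (a + M + 1)) g.
  apply: leq_trans (leq_mul (leqnn _) sl3Y) _; move: gYh hr rl lK2 rK lK; clear; lia.
have [|y' [z2 z3 z4]] := @gap_exists l3 (a + l + 1) (x + g0 - (a + l + 1)) g.
  apply: leq_trans (leq_mul (leqnn _) sl3Y) _; move: (leq_pmull r K0) gYh hr lK rK ax; clear; lia.
exists a, (a + l), (x + g0), x', y', g; split=> //.
- by split=> //; lia.
- by split; lia.
- move=> n nxy nG; have : n \in l3 by apply: Hl3 => //; lia.
  by apply/negP; case: nxy; [apply: y3|apply: z4].
(* With fewer elements of [A] or of [B], the representation of [a + l] would be one that [gapa]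
   excludes, so both lengths are exact. *)
- have [n1 n2] := gapa _ m2.
  case: aG => t1 [t2 [t1d t2e t1A t2B aE]].
  exists t1, (l :: t2); split => //=.
  + apply/eqP; rewrite eqn_leq t1d /= ltnNge; apply/negP => t1d'.
    apply: n1; exists t1, (l :: t2); split=> //=; [lia| |lia].
    by move=> u; rewrite inE => /orP[/eqP->|/t2B].
  + apply/eqP; rewrite eqn_leq ltnS t2e /= ltnNge; apply/negP => t2e'.
    apply: n2; exists t1, (l :: t2); split=> //=; last lia.
    by move=> u; rewrite inE => /orP[/eqP->|/t2B].
  + by move=> u; rewrite inE => /orP[/eqP->|/t2B].
  + lia.
Qed.

(** At the scales given by [doubling], the ratio of [N] to [g] is bounded by a fixed power of the
    counts at [2 * N], hence by an arbitrarily small power of [N]. *)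
Lemma arbitrarily_large_windows (A B : set nat) (lA lB : nat -> nat) (d e L M k : nat) :
  counted A lA -> counted B lB -> {homo lA : x y / x <= y} ->
  {homo lB : x y / x <= y} -> eventually_le lA -> eventually_le lB ->
  unbounded lA -> unbounded lB ->
  (exists N0, forall r, N0 <= r -> exists s : seq nat, [/\ size s = d.+1,
     {in s, forall x, A x}, sumn s < r &
     (r - sumn s) * (lA r ^ d * lB r ^ L.+1) < r]) ->
  (exists K N1, 0 < K /\ forall r, N1 <= r -> exists2 l, B l & r <= l < K * r) ->
  e < L -> 0 < k ->
  forall N0, exists a m b x y g : nat,
   [/\ N0 <= a /\ b ^ k.-1 <= g ^ k,
       [/\ a + M < x, x + g <= m, m < y & y + g <= b],
       forall n, a < n < b -> ~ mixed_sums A B d L n /\ ~ mixed_sums A B d.+1 e n,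
       forall n, x <= n < x + g \/ y <= n < y + g -> ~ mixed_sums A B d.+1 L n &
       exists s1 s2, [/\ size s1 = d.+1, size s2 = e.+1,
         {in s1, forall x, A x}, {in s2, forall x, B x} & m = sumn s1 + sumn s2] ].
Proof.
move=> cA cB mA mB sA sB uA uB [Nc c3] [K [N1 [K0 c1]]] eL k0 N0.
pose J := 2 * (d.+1 + L) + 1.
have sAB := eventually_le_mul sA sB.
(* [3 * J] pays for the cube of [z ^ J] and the 2 for the constants; the factor [k] keeps even the
   [k]-th power of the total loss below [N]. *)
have [Ns Hs] := eventually_le_double sAB ((3 * J + 2) * k).
have [NA HA] := uA 2.
have [NB HB] := uB (32 * 8 ^ (d + L) + 1024 * K * (M + N1 + 1)).
have [|N NN dbl] := @doubling _ (N0 + Nc + Ns + NA + NB) sAB.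
  move=> N NN; rewrite muln_gt0; apply/andP; split.
    by apply: leq_trans (HA _ _); lia.
  by apply: leq_trans (HB _ _); [have := expn_gt0 8 (d + L)|]; lia.
have lA1 : 1 < lA N by apply: HA; lia.
have lBN := HB N ltac:(lia).
have z1 : 1024 * K * (M + N1 + 1) <= lA (2 * N) * lB (2 * N).
  apply: (@leq_trans (lB (2 * N))); first by apply: leq_trans (mB N (2 * N) _); lia.
  by rewrite leq_pmull //; apply: leq_trans (mA N (2 * N) _); lia.
have zN := Hs N ltac:(lia).
have [z zE] : exists z, z = lA (2 * N) * lB (2 * N) by exists (lA (2 * N) * lB (2 * N)).
rewrite -zE in z1 zN.
have KM : 0 < K * (M + N1 + 1) by rewrite muln_gt0 K0; lia.
have z0 : 0 < z by move: KM z1; rewrite -mulnA; clear; lia.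
have z3 : z ^ (3 * J + 1) <= N.
  apply: leq_trans zN; rewrite leq_pexp2l //; move: k0; clear; case: k => // k _; lia.
have bigN : 256 * K * (M + N1 + 1) * (z ^ J) ^ 3 <= N.
  apply: leq_trans z3; rewrite -expnM [J * 3]mulnC [3 * J + 1]addn1 [z ^ _.+1]expnS leq_mul2r.
  by apply/orP; right; apply: leq_trans z1; rewrite -!mulnA; apply: leq_mul.
have [a [m [b [x [y [g [[h1 h2 h3] H2 H3 H4 H5]]]]]]] :=
  @window_in_scale A B lA lB d e L K M N N1 cA cB mA mB ltac:(move=> r rN; apply: c3; lia)
   K0 c1 dbl lA1 ltac:(lia) eL _ (congr1 (fun u => u ^ J) zE) bigN.
exists a, m, b, x, y, g; split=> //; split; first lia.
have bN : b ^ k.-1 <= (2 * N) ^ k.-1 by apply: leq_expn.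
apply: (leq_trans bN); set X := 512 * K * (z ^ J) ^ 3 in h3.
have X0 : 0 < X by rewrite !muln_gt0 K0 !expn_gt0 z0.
have XN : (2 * X) ^ k <= 2 * N.
  apply: (@leq_trans N); last lia.
  apply: leq_trans zN; rewrite expnM; apply: leq_expn.
  apply: (@leq_trans (z ^ (3 * J + 1))); last by rewrite leq_pexp2l //; lia.
  rewrite /X -expnM [J * 3]mulnC [3 * J + 1]addn1 expnS !mulnA leq_mul //.
  by apply: leq_trans z1; rewrite leq_pmulr // addn1.
(* Since [(2 * X) ^ k <= 2 * N], it suffices to compare [(2 * N) ^ k] with [(2 * X * g) ^ k]. *)
rewrite -(@leq_pmul2l ((2 * X) ^ k)); last by rewrite expn_gt0 muln_gt0 X0.
apply: (@leq_trans ((2 * N) ^ k)).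
  by apply: (leq_trans (leq_mul XN (leqnn _))); rewrite -expnS prednK.
by rewrite -expnMn; apply: leq_expn; lia.
Qed.

End WindowsOfSums.

(** * Coefficients of truncated power series *)

Definition trunc (t : nat -> nat) (B : nat) : {poly int} := \poly_(m < B) (t m)%:Z.

Definition nneg_coefs (p : {poly int}) := forall n, 0 <= p`_n.

Lemma nneg_coefs1 : nneg_coefs 1.
Proof. by move=> n; rewrite coef1; case: eqP. Qed.

Lemma nneg_coefs_trunc t B : nneg_coefs (trunc t B).
Proof. by move=> n; rewrite coef_poly; case: ifP. Qed.

Lemma nneg_coefsM p q : nneg_coefs p -> nneg_coefs q -> nneg_coefs (p * q).
Proof. by move=> p0 q0 n; rewrite coefM sumr_ge0 // => i _; rewrite mulr_ge0. Qed.

Lemma nneg_coefsX p i : nneg_coefs p -> nneg_coefs (p ^+ i).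
Proof.
by move=> p0; elim: i => [|i IH]; [exact: nneg_coefs1|rewrite exprS; exact: nneg_coefsM].
Qed.

Lemma coefM_gt0 p q i j : nneg_coefs p -> nneg_coefs q ->
  0 < p`_i -> 0 < q`_j -> 0 < (p * q)`_(i + j).
Proof.
move=> p0 q0 pi qj; rewrite coefM.
have ilt : (i < (i + j).+1)%N by rewrite ltnS leq_addr.
rewrite (bigD1 (Ordinal ilt)) //= addKn ltr_pwDl ?mulr_gt0 // sumr_ge0 // => u _.
by rewrite mulr_ge0.
Qed.

Definition coefs_in (P : set nat) (p : {poly int}) := forall n, p`_n != 0 -> P n.

Lemma coefM_neq0 (p q : {poly int}) n : (p * q)`_n != 0 ->
  exists2 i, (i <= n)%N & p`_i != 0 /\ q`_(n - i) != 0.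
Proof.
move=> pq0; apply: contrapT => H; case/negP: pq0; rewrite coefM big1 // => i _.
apply/eqP; apply: contrapT => /negP; rewrite mulf_eq0 negb_or => /andP[pi qi].
by apply: H; exists i => //; rewrite -ltnS.
Qed.

(** Only coefficients of index below [B] are those of the product of the full series; the later ones
    are affected by truncating each factor. *)
Definition monomial (t1 t2 t3 : nat -> nat) (k : nat * nat * nat) (B : nat) :=
  trunc t1 B ^+ k.1.1 * trunc t2 B ^+ k.1.2 * trunc t3 B ^+ k.2.

Lemma nneg_coefs_monomial t1 t2 t3 k B : nneg_coefs (monomial t1 t2 t3 k B).
Proof.
by apply: nneg_coefsM; [apply: nneg_coefsM|]; apply: nneg_coefsX; apply: nneg_coefs_trunc.
Qed.

Lemma coefs_in_mull (A C : set nat) (t : nat -> nat) B d j p :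
  (forall m, ~ A m -> t m = 0%N) ->
  coefs_in (mixed_sums A C d j) p -> coefs_in (mixed_sums A C d.+1 j) (trunc t B * p).
Proof.
move=> tA pd n /coefM_neq0[i ni [ti pi]].
have Ai : A i.
  apply: contrapT => /tA ti0; move: ti; rewrite coef_poly ti0; by case: ifP; rewrite eqxx.
have [s1 [s2 [h1 h2 h3 h4 h5]]] := pd _ pi.
exists (i :: s1), s2; split=> //=; last by rewrite -addnA -h5 subnKC.
by move=> x; rewrite inE => /orP[/eqP->|/h3].
Qed.

Lemma coefs_in_mulr (A C : set nat) (t : nat -> nat) B d j p :
  (forall m, ~ C m -> t m = 0%N) ->
  coefs_in (mixed_sums A C d j) p -> coefs_in (mixed_sums A C d j.+1) (trunc t B * p).
Proof.
move=> tC pd n /coefM_neq0[i ni [ti pi]].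
have Ci : C i.
  apply: contrapT => /tC ti0; move: ti; rewrite coef_poly ti0; by case: ifP; rewrite eqxx.
have [s1 [s2 [h1 h2 h3 h4 h5]]] := pd _ pi.
exists s1, (i :: s2); split=> //=; last by rewrite addnCA -h5 subnKC.
by move=> x; rewrite inE => /orP[/eqP->|/h4].
Qed.

Lemma coefs_in_monomial (A C : set nat) t1 t2 t3 k B :
  (forall m, ~ A m -> t1 m = 0%N) -> (forall m, ~ A m -> t2 m = 0%N) ->
  (forall m, ~ C m -> t3 m = 0%N) ->
  coefs_in (mixed_sums A C (k.1.1 + k.1.2) k.2) (monomial t1 t2 t3 k B).
Proof.
case: k => -[i i'] j h1 h2 h3; rewrite /monomial /= -mulrA.
elim: i => [|i IH]; last by rewrite exprS -mulrA; apply: coefs_in_mull.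
rewrite mul1r; elim: i' => [|i' IH]; last by rewrite exprS -mulrA; apply: coefs_in_mull.
rewrite mul1r; elim: j => [|j IH]; last by rewrite exprS; apply: coefs_in_mulr.
by move=> n; rewrite coef1; case: n => // _; exists [::], [::].
Qed.

(** All coefficients are nonnegative, so the contribution taking one prescribed exponent from each
    factor cannot be cancelled. *)
Lemma coef_monomial_gt0 (A C : set nat) t1 t2 t3 k B (s1 s2 : seq nat) :
  (forall m, A m -> 0 < t1 m)%N -> (forall m, A m -> 0 < t2 m)%N ->
  (forall m, C m -> 0 < t3 m)%N ->
  size s1 = (k.1.1 + k.1.2)%N -> size s2 = k.2 ->
  {in s1, forall x, A x} -> {in s2, forall x, C x} ->
  (sumn s1 + sumn s2 < B)%N ->
  0 < (monomial t1 t2 t3 k B)`_(sumn s1 + sumn s2).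
Proof.
case: k => -[i i'] j h1 h2 h3; rewrite /monomial /= -mulrA.
have tr t m : (m < B)%N -> (0 < t m)%N -> 0 < (trunc t B)`_m.
  by move=> mB tm; rewrite coef_poly mB.
have nn := nneg_coefs_trunc.
elim: i s1 => [|i IH] s1.
  rewrite mul1r; elim: i' s1 => [|i' IH] s1.
    rewrite mul1r; elim: j s2 => [|j IH] s2.
      by move=> /size0nil -> /size0nil -> _ _ _; rewrite coef1.
    move=> s10; case: s2 => // c s2 [sj] _ H; rewrite exprS (size0nil s10) /= add0n => cB.
    apply: coefM_gt0 => //; [exact: nneg_coefsX| |].
      by apply: tr; [lia|apply: h3; apply: H; exact: mem_head].
    have := IH s2 s10 sj; rewrite (size0nil s10) add0n; apply => //; last lia.
    by move=> x xs; apply: H; rewrite inE xs orbT.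
  case: s1 => // a s1 [si] sj HA HC; rewrite exprS -mulrA /= -addnA => cB.
  apply: coefM_gt0 => //; [by apply: nneg_coefsM; apply: nneg_coefsX| |].
    by apply: tr; [lia|apply: h2; apply: HA; exact: mem_head].
  by apply: IH => //; [move=> x xs; apply: HA; rewrite inE xs orbT|lia].
case: s1 => // a s1 [si] sj HA HC; rewrite exprS -mulrA /= -addnA => cB.
apply: coefM_gt0 => //; [by apply: nneg_coefsM; [|apply: nneg_coefsM]; apply: nneg_coefsX| |].
  by apply: tr; [lia|apply: h1; apply: HA; exact: mem_head].
by apply: IH => //; [move=> x xs; apply: HA; rewrite inE xs orbT|lia].
Qed.

Definition same_coefs (N : nat) (p q : {poly int}) := forall n, (n < N)%N -> p`_n = q`_n.

Lemma same_coefsM N p p' q q' : same_coefs N p p' -> same_coefs N q q' ->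
  same_coefs N (p * q) (p' * q').
Proof.
move=> hp hq n nN; rewrite !coefM; apply: eq_bigr => i _.
by rewrite hp ?hq //; [lia|have := ltn_ord i; lia].
Qed.

Lemma same_coefsX N p p' i : same_coefs N p p' -> same_coefs N (p ^+ i) (p' ^+ i).
Proof. by move=> hp; elim: i => [|i IH] //; rewrite !exprS; apply: same_coefsM. Qed.

Lemma same_coefs_monomial t1 t2 t3 k N B B' : (N <= B)%N -> (N <= B')%N ->
  same_coefs N (monomial t1 t2 t3 k B) (monomial t1 t2 t3 k B').
Proof.
move=> NB NB'; have H t : same_coefs N (trunc t B) (trunc t B').
  by move=> n nN; rewrite !coef_poly !(leq_trans nN).
by apply: same_coefsM; [apply: same_coefsM|]; apply: same_coefsX.
Qed.

(* In every nonzero contribution to the coefficient on the left, the factor [t2]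
   that is traded for [t1] is taken at an index exceeding [M]. *)
Lemma coef_dominated (A C : set nat) t1 t2 t3 (T M : nat) i i' j B n :
  (forall m, ~ A m -> t1 m = 0%N) -> (forall m, ~ A m -> t2 m = 0%N) ->
  (forall m, ~ C m -> t3 m = 0%N) ->
  (forall m, M < m -> T * t2 m <= t1 m)%N ->
  (forall m, m <= M -> m <= n -> ~ mixed_sums A C (i + i') j (n - m))%N ->
  T%:Z * (monomial t1 t2 t3 (i, i'.+1, j) B)`_n <= (monomial t1 t2 t3 (i.+1, i', j) B)`_n.
Proof.
move=> h1 h2 h3 ht hn; rewrite /monomial /=.
rewrite [trunc t2 B ^+ _]exprS [trunc t1 B ^+ i.+1]exprS mulrCA -!mulrA.
set Q := trunc t1 B ^+ i * _.
have QE : Q = monomial t1 t2 t3 (i, i', j) B by rewrite /Q /monomial /= mulrA.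
rewrite !coefM mulr_sumr; apply: ler_sum => -[m /= mn] _.
have [->|Qm] := eqVneq Q`_(n - m) 0; first by rewrite !mulr0.
rewrite mulrA ler_wpM2r //; first by rewrite QE; apply: nneg_coefs_monomial.
rewrite !coef_poly; case: ifP => _; last by rewrite mulr0.
rewrite -PoszM lez_nat ht // ltnNge; apply/negP => mM.
apply: (hn m mM mn); apply: (@coefs_in_monomial A C t1 t2 t3 (i, i', j) B) => //.
by rewrite -QE.
Qed.

Definition combination (a : nat * nat * nat -> int) (ks : seq (nat * nat * nat))
    t1 t2 t3 B : {poly int} :=
  \sum_(k <- ks) (a k)%:P * monomial t1 t2 t3 k B.

Lemma coef_combination a ks t1 t2 t3 B n :
  (combination a ks t1 t2 t3 B)`_n =
  \sum_(k <- ks) a k * (monomial t1 t2 t3 k B)`_n.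
Proof. by rewrite coef_sum; apply: eq_bigr => k _; rewrite coefCM. Qed.

(** Each of [u.+1] steps trades one factor [t2] for [t1]; a single gain of [T] is kept. *)
Lemma coef_dominated_iter (A C : set nat) t1 t2 t3 (T M : nat) u i i' j B n :
  (forall m, ~ A m -> t1 m = 0%N) -> (forall m, ~ A m -> t2 m = 0%N) ->
  (forall m, ~ C m -> t3 m = 0%N) -> (0 < T)%N ->
  (forall m, M < m -> T * t2 m <= t1 m)%N ->
  (forall m, m <= M -> m <= n -> ~ mixed_sums A C (i + i' + u) j (n - m))%N ->
  T%:Z * (monomial t1 t2 t3 (i, (i' + u).+1, j) B)`_n <=
  (monomial t1 t2 t3 ((i + u).+1, i', j) B)`_n.
Proof.
move=> h1 h2 h3 T0 ht; elim: u i' => [|u IH] i' hn.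
  by rewrite !addn0; apply: (coef_dominated _ h1 h2 h3 ht) => m mM mn; rewrite -[(i + i')%N]addn0; apply: hn.
rewrite -addSnnS; apply: (le_trans (IH i'.+1 _)).
  by move=> m mM mn; have -> : (i + i'.+1 + u = i + i' + u.+1)%N by [lia]; apply: hn.
apply: (@le_trans _ _ (T%:Z * (monomial t1 t2 t3 ((i + u).+1, i'.+1, j) B)`_n)).
  by rewrite ler_peMl ?nneg_coefs_monomial // -[1]/(1%:Z) lez_nat.
rewrite addnS; apply: (coef_dominated _ h1 h2 h3 ht) => m mM mn.
by have -> : ((i + u).+1 + i' = i + i' + u.+1)%N by [lia]; apply: hn.
Qed.

(** Inside the window only monomials of joint degree [d.+1] and third degree [e.+1] have nonzero
    coefficients. Any of them other than [k0] has a smaller exponent of [t1], so [T] times its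
    coefficient is at most that of [k0]; as [T] exceeds the sum of the absolute values of the [a k],
    the term of [k0] prevails. *)
Lemma combination_window (A C : set nat) t1 t2 t3 (T M d e L x y n B : nat)
    (a : nat * nat * nat -> int) ks k0 :
  (forall m, ~ A m -> t1 m = 0%N) -> (forall m, ~ A m -> t2 m = 0%N) ->
  (forall m, ~ C m -> t3 m = 0%N) ->
  (forall m, M < m -> T * t2 m <= t1 m)%N ->
  uniq ks -> k0 \in ks -> (k0.1.1 + k0.1.2 = d.+1)%N -> k0.2 = e.+1 ->
  0 < a k0 -> \sum_(k <- ks) `|a k| < T%:Z ->
  (forall k, k \in ks -> [/\ (k.1.1 + k.1.2 <= d.+1)%N, (k.2 <= L)%N,
     ((k.1.1 + k.1.2)%N = d.+1 -> k.2 <= e.+1)%N &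
     ((k.1.1 + k.1.2)%N = d.+1 -> k.2 = e.+1 -> k.1.1 <= k0.1.1)%N]) ->
  (forall n, x < n < y -> ~ mixed_sums A C d L n /\ ~ mixed_sums A C d.+1 e n)%N ->
  (x + M < n < y)%N ->
  (monomial t1 t2 t3 k0 B)`_n <= T%:Z * (combination a ks t1 t2 t3 B)`_n.
Proof.
move=> h1 h2 h3 ht uks k0s k0d k0e a0 aT hk hxy xny.
have T0 : (0 < T)%N.
  by rewrite -ltz_nat; apply: le_lt_trans aT; apply: sumr_ge0.
set c0 := (monomial t1 t2 t3 k0 B)`_n.
have c0_ge0 : 0 <= c0 by apply: nneg_coefs_monomial.
have [nd ne] := hxy n ltac:(lia).
have H (k : nat * nat * nat) : k \in ks -> k != k0 ->
    - `|a k| * c0 <= T%:Z * (a k * (monomial t1 t2 t3 k B)`_n).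
  move=> kks kk0; have [k1 k2 k3 k4] := hk k kks.
  have kin := @coefs_in_monomial A C t1 t2 t3 k B h1 h2 h3 n.
  have [->|k_n0] := eqVneq (monomial t1 t2 t3 k B)`_n 0.
    by rewrite !mulr0 mulNr oppr_le0 mulr_ge0.
  have {}kin := kin k_n0.
  have kd : (k.1.1 + k.1.2)%N = d.+1.
    apply/eqP; rewrite eqn_leq k1 /= ltnNge; apply/negP => kd.
    by apply: nd; apply: (mixed_sumsS kd k2).
  have ke : k.2 = e.+1.
    apply/eqP; rewrite eqn_leq k3 //= ltnNge; apply/negP => ke.
    by apply: ne; apply: (mixed_sumsS k1 ke).
  have dom : T%:Z * (monomial t1 t2 t3 k B)`_n <= c0.
    have [u [u1 u2]] : exists u, k0.1.1 = (k.1.1 + u).+1 /\ k.1.2 = (k0.1.2 + u).+1.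
      have ii : (k.1.1 < k0.1.1)%N.
        rewrite ltn_neqAle k4 // andbT; apply: contraNneq kk0 => E5.
        have E6 : k.1.2 = k0.1.2 by lia.
        by rewrite [k]surjective_pairing [k.1]surjective_pairing E5 E6 ke -k0e -!surjective_pairing.
      by exists (k0.1.1 - k.1.1.+1)%N; lia.
    have kE : k = (k.1.1, (k0.1.2 + u).+1, e.+1).
      by rewrite -u2 -ke -!surjective_pairing.
    have k0E : k0 = ((k.1.1 + u).+1, k0.1.2, e.+1).
      by rewrite -u1 -k0e -!surjective_pairing.
    rewrite /c0 kE k0E /=; apply: (coef_dominated_iter _ h1 h2 h3 T0 ht) => m mM mn nG.
    (* Removing an index [m <= M] stays inside the window, by the margin [M], where no sum of at
       most [d] elements of [A] and [L] of [C] occurs. *)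
    have [] := hxy (n - m)%N ltac:(lia); case.
    apply: mixed_sumsS nG; last by rewrite -ke.
    by rewrite -ltnS -kd u2 addnS addnA.
  rewrite mulrCA mulNr lerNl -mulNr; apply: (@le_trans _ _ (`|a k| * (T%:Z * (monomial t1 t2 t3 k B)`_n))).
    by rewrite ler_wpM2r ?mulr_ge0 ?nneg_coefs_monomial // -normrN ler_norm.
  exact: ler_wpM2l.
rewrite coef_combination mulr_sumr (bigD1_seq k0) //= -/c0.
have S1 : \sum_(k <- ks) `|a k| = `|a k0| + \sum_(k <- ks | k != k0) `|a k|.
  by rewrite (bigD1_seq k0).
have S2 : - (\sum_(k <- ks | k != k0) `|a k|) * c0 <=
    \sum_(k <- ks | k != k0) T%:Z * (a k * (monomial t1 t2 t3 k B)`_n).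
  rewrite -sumrN mulr_suml big_seq_cond [leRHS]big_seq_cond.
  by apply: ler_sum => k /andP[kks kk0]; apply: H.
apply: le_trans (lerD (lexx _) S2).
rewrite mulrA -mulrDl ler_peMl //.
move: aT; rewrite S1 (ger0_norm (ltW a0)); move: (\sum_(k <- _ | _) _) => s aT.
have Ta : T%:Z <= T%:Z * a k0 by rewrite ler_peMr // -gtz0_ge1.
by move: (T%:Z * a k0) (T%:Z) (a k0) a0 aT Ta => u v w; lia.
Qed.

(** * Partial sums before a gap *)

Definition tame (R : realType) (w : nat -> R) (p : nat -> {poly int}) :=
  exists (Q : R) (U : nat), 0 <= Q /\
    forall B n, (`|(p B)`_n|)%:~R <= Q * w n ^+ U.

(** The lower bound lets one factor of the weight absorb the number of terms of a Cauchy product,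
    and monotonicity bounds the weights of the indices in it by the weight at [n]. *)
Definition weight (R : realType) (w : nat -> R) :=
  (forall n, n.+1%:R <= w n) /\ {homo w : m n / (m <= n)%N >-> m <= n}.

Lemma weight_ge1 (R : realType) (w : nat -> R) n : weight w -> 1 <= w n.
Proof. by case=> w1 _; apply: le_trans (w1 n); rewrite ler1n. Qed.

Lemma tame_cst (R : realType) (w : nat -> R) (c : int) :
  weight w -> tame w (fun=> c%:P).
Proof.
move=> hw; exists (`|c|%:~R), 0%N; split; first by rewrite ler0z.
move=> B n; rewrite expr0 mulr1 ler_int coefC.
by case: ifP => _; rewrite ?normr0.
Qed.

Lemma tame_trunc (R : realType) (w : nat -> R) t :
  weight w -> (forall n, (t n)%:R <= w n) -> tame w (trunc t).
Proof.
move=> hw tw; exists 1, 1%N; split=> // B n; rewrite expr1 mul1r coef_poly.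
case: ifP => _; first by rewrite ger0_norm //; apply: tw.
by rewrite normr0 (le_trans ler01) // weight_ge1.
Qed.

Lemma tameD (R : realType) (w : nat -> R) p q :
  weight w -> tame w p -> tame w q -> tame w (fun B => p B + q B).
Proof.
move=> hw [Q [U [Q0 pQ]]] [Q' [U' [Q'0 qQ']]].
exists (Q + Q'), (U + U')%N; split; first exact: addr_ge0.
move=> B n; rewrite coefD; have w1 := weight_ge1 n hw.
apply: (@le_trans _ _ ((`|(p B)`_n| + `|(q B)`_n|)%:~R)).
  by rewrite ler_int ler_normD.
rewrite rmorphD mulrDl /=; apply: lerD.
  apply: (le_trans (pQ B n)); rewrite ler_wpM2l // ler_weXn2l //; exact: leq_addr.
apply: (le_trans (qQ' B n)); rewrite ler_wpM2l // ler_weXn2l //; exact: leq_addl.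
Qed.

Lemma tameM (R : realType) (w : nat -> R) p q :
  weight w -> tame w p -> tame w q -> tame w (fun B => p B * q B).
Proof.
move=> hw [Q [U [Q0 pQ]]] [Q' [U' [Q'0 qQ']]].
exists (Q * Q'), (U + U').+1; split; first exact: mulr_ge0.
move=> B n; have w0 m : 0 <= w m by apply: le_trans (weight_ge1 m hw).
apply: (@le_trans _ _ (\sum_(i < n.+1) (`|(p B)`_i| * `|(q B)`_(n - i)|)%:~R)).
  rewrite -(rmorph_sum intr) /= ler_int coefM.
  by apply: (le_trans (ler_norm_sum _ _ _)); apply: ler_sum => i _; rewrite normrM.
apply: (@le_trans _ _ (\sum_(i < n.+1) Q * Q' * w n ^+ (U + U'))).
  apply: ler_sum => i _; rewrite rmorphM exprD mulrACA /=.
  have wi : w i <= w n by apply: hw.2; rewrite -ltnS.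
  have wni : w (n - i)%N <= w n by apply: hw.2; rewrite leq_subr.
  apply: ler_pM; rewrite ?ler0z //.
    by apply: (le_trans (pQ _ _)); rewrite ler_wpM2l // lerXn2r // nnegrE.
  by apply: (le_trans (qQ' _ _)); rewrite ler_wpM2l // lerXn2r // nnegrE.
rewrite sumr_const card_ord -mulr_natl mulrCA ler_wpM2l ?mulr_ge0 //.
by rewrite exprS ler_wpM2r ?exprn_ge0 // hw.1.
Qed.

Lemma tameX (R : realType) (w : nat -> R) p i :
  weight w -> tame w p -> tame w (fun B => p B ^+ i).
Proof.
move=> hw pt; elim: i => [|i IH].
  have -> : (fun B => p B ^+ 0) = fun=> 1%:P by apply/funext => B; rewrite expr0.
  exact: tame_cst.
have -> : (fun B => p B ^+ i.+1) = (fun B => p B * p B ^+ i).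
  by apply/funext => B; rewrite exprS.
exact: tameM.
Qed.

Lemma tame_combination (R : realType) (w : nat -> R) a ks t1 t2 t3 : weight w ->
  (forall n, (t1 n)%:R <= w n) -> (forall n, (t2 n)%:R <= w n) ->
  (forall n, (t3 n)%:R <= w n) -> tame w (combination a ks t1 t2 t3).
Proof.
move=> hw h1 h2 h3; elim: ks => [|k ks IH].
  have -> : combination a [::] t1 t2 t3 = fun=> 0%:P.
    by apply/funext => B; rewrite /combination big_nil.
  exact: tame_cst.
have -> : combination a (k :: ks) t1 t2 t3 =
    (fun B => (a k)%:P * monomial t1 t2 t3 k B + combination a ks t1 t2 t3 B).
  by apply/funext => B; rewrite /combination big_cons.
apply: tameD => //; apply: tameM => //; first exact: tame_cst.
by apply: tameM => //; [apply: tameM => //|]; apply: tameX => //; apply: tame_trunc.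
Qed.

(* [N ^ k.-1 <= h ^ k] says [N ^ (1 - 1 / k) <= h]. *)
Definition subexponential (R : realType) (w : nat -> R) (k : nat) :=
  forall (g : R) (U : nat), 1 < g -> exists N0 : nat, forall N h : nat,
    (N0 <= N)%N -> (N ^ k.-1 <= h ^ k)%N -> w (N + h)%N ^+ U <= g ^+ h.

Lemma geometric_tail (R : realType) (q : R) (h s : nat) : 0 <= q < 1 ->
  \sum_(h <= m < s) q ^+ m <= q ^+ h / (1 - q).
Proof.
move=> /andP[q0 q1]; have q1' : 0 < 1 - q by rewrite subr_gt0.
rewrite ler_pdivlMr //.
have [sh|hs] := leqP s h; first by rewrite big_geq // mul0r exprn_ge0.
rewrite -{1}(add0n h) big_addn.
under eq_bigr do rewrite exprD.
rewrite -mulr_suml big_mkord mulrC mulrA -[1]opprK -opprD addrC.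
rewrite mulNr -[X in - X * _]subrX1 opprB.
by rewrite ler_piMl ?exprn_ge0 // gerBl exprn_ge0.
Qed.

(** The decay of the powers of [b^-1] is shared out in four: one part absorbs the coefficients of
    the tail, one the conjugates, and two keep the final bound below 1. *)
Lemma exists_root4 (R : rcfType) (b : R) : 1 < b -> exists2 g : R, 1 < g & g ^+ 4 = b.
Proof.
move=> b1; exists (Num.sqrt (Num.sqrt b)).
  by rewrite -sqrtr1 ltr_sqrt ?sqrtr_gt0 ?(lt_trans ltr01) // -sqrtr1 ltr_sqrt // (lt_trans ltr01).
rewrite -[4%N]/(2 * 2)%N exprM !sqr_sqrtr ?sqrtr_ge0 //.
exact/ltW/(lt_trans ltr01).
Qed.

(* The partial sum times a power of [b] is an element of [Z[b]] whose norm is too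
   small to be a nonzero integer. *)
Lemma partial_sum_before_gap (R : realType) (b : R) (w : nat -> R) (k : nat)
    (G : nat -> {poly int}) (c : nat -> int) :
  pisot b \/ salem b -> weight w -> subexponential w k -> tame w G -> (0 < k)%N ->
  (forall B n, (n < B)%N -> (G B)`_n = c n) ->
  (map_poly intr (G B)).[b^-1] @[B --> \oo] --> (0 : R) ->
  exists N0 : nat, forall N h : nat, (N0 <= N)%N -> (N ^ k.-1 <= h ^ k)%N ->
    (forall n, (N <= n < N + h)%N -> c n = 0) ->
    \sum_(n < N) (c n)%:~R * b^-1 ^+ n = 0.
Proof.
move=> Hb hw sw [Q [U [Q0 GQ]]] k0 Gc Glim.
have [d dP] := norm_lower_bound Hb.
have b1 : 1 < b by case: Hb => -[].
have [g g1 gb] := exists_root4 b1.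
have g0 : 0 < g by apply: lt_trans g1.
have b0 : 0 < b by apply: lt_trans b1.
have cQ n : `|(c n)%:~R : R| <= Q * w n ^+ U.
  by rewrite -(Gc n.+1) // -intr_norm.
pose q := g^-1 ^+ 3.
have q01 : 0 <= q < 1.
  rewrite exprn_ge0 ?invr_ge0 ?ltW //= exprn_ilt1 // ?invr_ge0 ?(ltW g0) // invf_lt1 //.
have [qge0 qlt1] := andP q01.
pose C := Q ^+ d.+1 / (1 - q).
have C0 : 0 <= C by rewrite divr_ge0 ?exprn_ge0 // subr_ge0 ltW.
have [N1 H1] := sw g U g1.
(* The power [U.+1 * d] comes from the norm estimate; one more factor of the weight absorbs the
   constant [C]. *)
have [N2 H2] := sw g (U.+1 * d).+1 g1.
have [N3 H3] : exists N3 : nat, C <= N3%:R.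
  by exists (Num.bound C); apply/ltW/archi_boundP.
exists (N1 + N2 + N3).+1 => N h NN Nh gap.
have h0 : (0 < h)%N.
  case: h {gap} Nh => // ; rewrite exp0n // leqn0 expn_eq0; clear -NN; lia.
pose s : R := \sum_(n < N) (c n)%:~R * b^-1 ^+ n.
have w0 n : 0 <= w n by apply: le_trans (weight_ge1 n hw).
have tailb B : (N + h <= B)%N ->
    `|s - (map_poly intr (G B)).[b^-1]| <= b^-1 ^+ N * (Q * (q ^+ h / (1 - q))).
  move=> NB.
  (* From [B] on, the coefficients of [G B] may differ from [c]; tameness bounds them too, so the
     tail runs up to [S]. *)
  pose S := maxn (size (G B)) B.
  have -> : (map_poly intr (G B)).[b^-1] = \sum_(0 <= n < S) ((G B)`_n)%:~R * b^-1 ^+ n.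
    rewrite (@horner_coef_wide _ S); last by rewrite (leq_trans (size_poly _ _)) // leq_maxl.
    by rewrite big_mkord; apply: eq_bigr => i _; rewrite coef_map.
  have NS : (N <= S)%N by rewrite (leq_trans _ (leq_maxr _ _)) //; clear -NB; lia.
  rewrite (@big_cat_nat _ _ _ N) //= big_mkord.
  have -> : s = \sum_(n < N) ((G B)`_n)%:~R * b^-1 ^+ n.
    by apply: eq_bigr => i _; rewrite Gc //; have := ltn_ord i; clear -NB; lia.
  rewrite opprD addrA subrr add0r normrN.
  have NhS : (N + h <= S)%N by rewrite (leq_trans NB) // leq_maxr.
  rewrite (@big_cat_nat _ _ _ (N + h)) //=; last exact: leq_addr.
  rewrite big_nat big1 ?add0r; last first.
    by move=> n nN; rewrite Gc ?gap ?mul0r //; clear -nN NB; lia.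
  rewrite -{1}[(N + h)%N]addnC big_addn.
  apply: (le_trans (ler_norm_sum _ _ _)).
  apply: (@le_trans _ _ (\sum_(h <= m < S - N) b^-1 ^+ N * (Q * q ^+ m))).
    rewrite !big_nat; apply: ler_sum => m hm.
    have wm : w (m + N)%N ^+ U * b^-1 ^+ m <= q ^+ m.
      have -> : q ^+ m = g ^+ m * b^-1 ^+ m.
        by rewrite -exprMn -gb -exprVn [_ ^+ 4]exprS mulrA divff ?mul1r // gt_eqF.
      rewrite ler_wpM2r ?exprn_ge0 ?invr_ge0 ?(ltW b0) // addnC H1 //; first by clear -NN; lia.
      by apply: (leq_trans Nh); apply: leq_expn; case/andP: hm.
    rewrite normrM [ `|_ ^+ _| ]ger0_norm ?exprn_ge0 ?invr_ge0 ?(ltW b0) //.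
    apply: (@le_trans _ _ (Q * w (m + N)%N ^+ U * b^-1 ^+ (m + N))).
      by rewrite ler_wpM2r ?exprn_ge0 ?invr_ge0 ?(ltW b0) // -intr_norm.
    rewrite exprD [_ * b^-1 ^+ N]mulrC mulrCA ler_wpM2l ?exprn_ge0 ?invr_ge0 ?(ltW b0) //.
    by rewrite -mulrA ler_wpM2l.
  by rewrite -!mulr_sumr !ler_wpM2l ?exprn_ge0 ?invr_ge0 ?(ltW b0) // geometric_tail.
(* The bound is uniform in [B] and the values of [G B] tend to 0, so it passes to [s]. *)
have sb : `|s| <= b^-1 ^+ N * (Q * (q ^+ h / (1 - q))).
  have sl : `|s - (map_poly intr (G B)).[b^-1]| @[B --> \oo] --> `|s|.
    rewrite -{2}[s]subr0; apply: cvg_norm; apply: cvgB => //; exact: cvg_cst.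
  rewrite -(cvg_lim _ sl) //; apply: limr_le; first by apply/cvg_ex; exists `|s|.
  by exists (N + h)%N => // B /= NB; apply: tailb.
(* Reversing the coefficients writes [b ^+ N * s] as an element of [Z[b]]. Index 0 would stand for
   [c N], outside the partial sum. *)
pose p : {poly int} := \poly_(i < N.+1) (if i == 0%N then 0 else c (N - i)%N).
have pb : (map_poly intr p).[b] = b ^+ N * s.
  rewrite (@horner_coef_wide _ N.+1); last first.
    by rewrite (leq_trans (size_poly _ _)) // size_poly.
  rewrite big_ord_recl coef_map coef_poly /= mul0r add0r /s mulr_sumr.
  rewrite [RHS](reindex_inj rev_ord_inj) /=; apply: eq_bigr => i _.
  rewrite coef_map coef_poly /= ltnS ltn_ord mulrCA; congr (_ * _).
  rewrite exprVn -expfB_cond ?gt_eqF //=; last by rewrite leq_subr.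
  by congr (_ ^+ _); have := ltn_ord i; rewrite /bump /=; clear; lia.
have pw : (\sum_(i < size p) `|p`_i|)%:~R <= Q * w N ^+ U.+1.
  rewrite (rmorph_sum intr) /=.
  have X0 : 0 <= Q * w N ^+ U by rewrite mulr_ge0 ?exprn_ge0.
  apply: (@le_trans _ _ (\sum_(i < size p) Q * w N ^+ U)).
    apply: ler_sum => i _; rewrite coef_poly; case: ifP => _; last by rewrite normr0.
    case: eqP => _; first by rewrite normr0.
    rewrite intr_norm; apply: (le_trans (cQ _)).
    by rewrite ler_wpM2l // lerXn2r // ?nnegrE // hw.2 // leq_subr.
  rewrite sumr_const card_ord -mulr_natl exprS mulrCA ler_wpM2l //.
  rewrite ler_wpM2r ?exprn_ge0 //; apply: le_trans (hw.1 N).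
  by rewrite ler_nat size_poly.
apply: contrapT => /eqP s0; have := dP p; rewrite pb.
have bs0 : b ^+ N * s != 0 by apply: mulf_neq0 => //; rewrite expf_neq0 // gt_eqF.
move=> /(_ bs0); apply/negP; rewrite -ltNge.
have ps0 : 0 <= (\sum_(i < size p) `|p`_i|)%:~R :> R by rewrite ler0z sumr_ge0.
have Q1 : 0 <= Q * (q ^+ h / (1 - q)).
  by apply: mulr_ge0 => //; apply: divr_ge0; [exact: exprn_ge0|rewrite subr_ge0 ltW].
apply: (@le_lt_trans _ _ (Q * (q ^+ h / (1 - q)) * (Q * w N ^+ U.+1) ^+ d)).
  apply: ler_pM => //; first exact: exprn_ge0.
    rewrite normrM normrX ger0_norm ?(ltW b0) //.
    by rewrite -ler_pdivlMl ?exprn_gt0 // -exprVn.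
  by rewrite lerXn2r // nnegrE // mulr_ge0 ?exprn_ge0.
have -> : Q * (q ^+ h / (1 - q)) * (Q * w N ^+ U.+1) ^+ d =
    q ^+ h * (C * w N ^+ (U.+1 * d)).
  rewrite /C [(Q * _) ^+ d]exprMn [w N ^+ (_ * d)]exprM [Q ^+ d.+1]exprS.
  by move: (w N ^+ _ ^+ d) (q ^+ h) (Q ^+ d) => u v x; ring.
apply: (@le_lt_trans _ _ (q ^+ h * g ^+ h)).
  rewrite ler_wpM2l ?(exprn_ge0 _ qge0) //; apply: le_trans (H2 N h _ Nh); last by clear -NN; lia.
  rewrite exprS; apply: ler_pM => //; first exact: exprn_ge0.
    apply: (le_trans H3); apply: (le_trans _ (hw.1 _)); rewrite ler_nat; clear -NN; lia.
  by rewrite lerXn2r // ?nnegrE // hw.2 // leq_addr.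
have -> : q ^+ h * g ^+ h = g^-1 ^+ (2 * h).
  by rewrite -exprMn /q exprSr -mulrA mulVf ?gt_eqF // mulr1 exprM.
by rewrite exprn_ilt1 ?invr_ge0 ?(ltW g0) ?invf_lt1 // muln_eq0 -lt0n h0.
Qed.

(** * Stretched exponential weights *)

Definition exp_weight (R : realType) (K p : R) (n : nat) : R :=
  expR (K * n.+1%:R `^ p).

Lemma powR_succ_ge1 (R : realType) (p : R) n : 0 <= p -> 1 <= n.+1%:R `^ p.
Proof.
move=> p0; rewrite -[leLHS](@powRr0 R n.+1%:R).
by apply: ler_powR => //; rewrite ler1n.
Qed.

(** From [ln x < x] at [x = (n + 1) ^ p] one gets [ln (n + 1) <= p^-1 * (n + 1) ^ p], whence the
    condition on [K]. *)
Lemma weight_exp (R : realType) (K p : R) : 0 < p -> p^-1 <= K ->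
  weight (exp_weight K p).
Proof.
move=> p0 pK; have K0 : 0 <= K by apply: le_trans pK; rewrite invr_ge0 ltW.
split=> [n|m n mn]; rewrite /exp_weight.
  have n0 : 0 < n.+1%:R :> R by rewrite ltr0n.
  rewrite -[leLHS]lnK ?posrE // ler_expR.
  apply: (@le_trans _ _ (p^-1 * n.+1%:R `^ p)); last by rewrite ler_wpM2r ?powR_ge0.
  by rewrite ler_pdivlMl // -ln_powR ltW // ln_sublinear // powR_gt0.
rewrite ler_expR ler_wpM2l //.
by rewrite (ge0_ler_powR (ltW p0)) ?nnegrE ?ler0n // ler_nat.
Qed.

(** With [q = 1 - 1 / k], the gap condition reads [N ^ q <= h], so [(N + h + 1) ^ q <= 3 * h]. Since
    [p < q], the logarithm of the weight is eventually below any given positive multiple of [h]. *)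
Lemma subexponential_exp (R : realType) (K p : R) (k : nat) :
  0 <= K -> 0 < p -> (0 < k)%N -> k%:R^-1 < 1 - p -> subexponential (exp_weight K p) k.
Proof.
move=> K0 p0 k0 kp g U g1.
set q : R := 1 - k%:R^-1.
have pq : 0 < q - p by rewrite /q; lra.
have lg : 0 < ln g by apply: ln_gt0.
(* Chosen so that [x ^ (q - p) >= X] and [x ^ q <= 3 * h] give [U * K * x ^ p <= h * ln g]. *)
pose X := U%:R * K * 3%:R / ln g.
have X0 : 0 <= X by rewrite divr_ge0 ?mulr_ge0 // ltW.
exists (Num.bound (X `^ (q - p)^-1)).+1 => N h NX Nh.
have kR : 0 < k%:R :> R by rewrite ltr0n.
have q0 : 0 <= q by rewrite ltW // (lt_trans _ (_ : p < q)) //; lra.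
have h0 : (0 < h)%N.
  case: h Nh => // ; rewrite exp0n // leqn0 expn_eq0; clear -NX; lia.
have Nq : N%:R `^ q <= h%:R.
  rewrite -(@ler_pXn2r _ k) ?nnegrE ?powR_ge0 // -powR_mulrn ?powR_ge0 // -powRrM.
  have -> : q * k%:R = k.-1%:R.
    by rewrite /q mulrBl mul1r mulVf ?gt_eqF // -{1}(prednK k0) -natr1 addrK.
  by rewrite powR_mulrn // -!natrX ler_nat.
have hq : h%:R `^ q <= h%:R.
  apply: ler1_powR; first by rewrite ler1n.
  by rewrite /q gerBl invr_ge0 ltW.
have xq : (N + h).+1%:R `^ q <= 3%:R * h%:R.
  have : (N + h).+1%:R <= 3%:R * (maxn N h)%:R :> R.
    by rewrite -natrM ler_nat; clear -h0; lia.
  move=> /(@ge0_ler_powR _ q q0); rewrite !nnegrE ?ler0n ?mulr_ge0 // => /(_ isT isT) H.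
  apply: (le_trans H); rewrite powRM //; apply: ler_pM; rewrite ?powR_ge0 //.
    by apply: ler1_powR; rewrite ?ler1n // /q gerBl invr_ge0 ltW.
  by rewrite /maxn; case: ifP.
rewrite /exp_weight -expRM_natl -[g]lnK ?posrE ?(lt_trans ltr01) // -expRM_natl ler_expR.
set x : R := (N + h).+1%:R in xq *.
have x0 : 0 < x by rewrite ltr0n.
have Xx : X <= x `^ (q - p).
  have : X `^ (q - p)^-1 <= x.
    apply/ltW; apply: (lt_le_trans (archi_boundP (powR_ge0 _ _))).
    by rewrite ler_nat; clear -NX; lia.
  move=> /(@ge0_ler_powR _ (q - p) (ltW pq)).
  rewrite !nnegrE powR_ge0 (ltW x0) => /(_ isT isT).
  by rewrite -powRrM mulVf ?gt_eqF // powRr1.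
have xqE : x `^ q = x `^ p * x `^ (q - p).
  by rewrite -powRD ?(gt_eqF x0) ?implybT // addrC subrK.
have : X * x `^ p <= 3%:R * h%:R.
  by apply: le_trans xq; rewrite xqE mulrC ler_wpM2l ?powR_ge0.
rewrite /X mulrAC ler_pdivrMr // => H; rewrite -(@ler_pM2l _ 3%:R) //.
by rewrite !mulrA in H *; lra.
Qed.

(** Condition (4) settles large [n]; the finitely many other values are absorbed in [C]. Allowing
    every [K >= C] lets one weight serve all three series. *)
Lemma exp_weight_dominates (R : realType) (p : R) (t : nat -> nat) : 0 <= p ->
  (fun n => logplus ((t n)%:R : R)) =o_\oo (fun n => n%:R `^ p) ->
  exists2 C : R, 0 <= C & forall K, C <= K -> forall n, (t n)%:R <= exp_weight K p n.
Proof.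
move=> p0 /eqoP/(_ 1 ltr01)[N0 _ H].
exists (1 + (\sum_(m < N0) t m)%:R); first by rewrite addr_ge0.
move=> K CK n; have [Nn|nN] := leqP N0 n.
  have := H n Nn; rewrite mul1r ger0_norm; last by rewrite ln_ge0 // le_max lexx.
  rewrite ger0_norm ?powR_ge0 // => tn.
  have m0 : 0 < Num.max 1 (t n)%:R :> R by rewrite lt_max ltr01.
  apply: (@le_trans _ _ (Num.max 1 (t n)%:R)); first by rewrite le_max lexx orbT.
  rewrite -[leLHS]lnK ?posrE // ler_expR; apply: (le_trans tn).
  apply: (@le_trans _ _ (n.+1%:R `^ p)).
    by rewrite ge0_ler_powR ?nnegrE ?ler0n // ler_nat.
  rewrite ler_peMl ?powR_ge0 // (le_trans _ CK) // lerDl; exact: ler0n.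
apply: (@le_trans _ _ K).
  apply: le_trans CK; rewrite -[leLHS]add0r lerD // ler_nat.
  by rewrite (bigD1 (Ordinal nN)) //= leq_addr.
apply: (@le_trans _ _ (expR K)).
  by apply: le_trans (expR_ge1Dx K); rewrite lerDr.
rewrite ler_expR ler_peMr ?powR_succ_ge1 //.
by apply: le_trans CK; rewrite addr_ge0.
Qed.

(** * Convergence of the series and of their combinations *)

(** Subexponential growth with [N = N0] fixed and [h = n - N0] gives [t n <= C * g ^+ n] with
    [g < b], so a geometric series dominates. *)
Lemma is_cvg_psum (R : realType) (w : nat -> R) (k : nat) (t : nat -> nat) (b : R) :
  subexponential w k -> (0 < k)%N -> (forall n, (t n)%:R <= w n) -> 1 < b ->
  cvgn (pseries (fun m => (t m)%:R) b^-1).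
Proof.
move=> sw k0 tw b1.
have [g g1 gb] := exists_root4 b1.
have g0 : 0 < g by apply: lt_trans g1.
have b0 : 0 < b by apply: lt_trans b1.
have [N0 H] := sw g 1%N g1.
pose C : R := 1 + (\sum_(m < (N0 + N0).+1) t m)%:R.
have C1 : 1 <= C by rewrite lerDl.
have tC n : (t n)%:R <= C * g ^+ n.
  have [Nn|nN] := leqP (N0 + N0).+1 n.
    apply: (le_trans (tw n)).
    have := H N0 (n - N0)%N (leqnn _); rewrite expr1 subnKC; last by clear -Nn; lia.
    have Nk : (N0 ^ k.-1 <= (n - N0) ^ k)%N.
      apply: (@leq_trans ((n - N0) ^ k.-1)); first by apply: leq_expn; clear -Nn; lia.
      by rewrite leq_pexp2l ?leq_pred //; clear -Nn; lia.
    move=> /(_ Nk) wn; apply: (le_trans wn).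
    rewrite -[leLHS]mul1r; apply: ler_pM => //; first by rewrite exprn_ge0 ?ltW.
    by rewrite ler_weXn2l ?ltW // leq_subr.
  apply: (@le_trans _ _ C).
    rewrite -[leLHS]add0r lerD // ler_nat.
    by rewrite (bigD1 (Ordinal nN)) //= leq_addr.
  by rewrite ler_peMr ?(le_trans ler01) // exprn_ege1 // ltW.
apply: (@series_le_cvg _ _ (geometric C (g / b))) => [n|n|n|].
- by rewrite mulr_ge0 // exprn_ge0 // invr_ge0 ltW.
- by rewrite /=; apply: mulr_ge0; [exact: le_trans C1|apply: exprn_ge0; rewrite divr_ge0 // ltW].
- by rewrite /= exprMn mulrA ler_wpM2r // exprn_ge0 // invr_ge0 ltW.
- apply: is_cvg_geometric_series.
  rewrite ger0_norm ?divr_ge0 ?ltW // ltr_pdivrMr // mul1r -gb.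
  by rewrite -[ltLHS]expr1 ltr_eXn2l.
Qed.

Lemma horner_trunc (R : realType) (t : nat -> nat) (x : R) B :
  (map_poly intr (trunc t B)).[x] = pseries (fun m => (t m)%:R) x B.
Proof.
rewrite (@horner_coef_wide _ B).
  rewrite /pseries /series /= big_mkord; apply: eq_bigr => i _.
  by rewrite coef_map coef_poly ltn_ord.
by rewrite (leq_trans (size_poly _ _)) // size_poly.
Qed.

Lemma cvg_combination (R : realType) (x y1 y2 y3 : R) a ks t1 t2 t3 :
  pseries (fun m => (t1 m)%:R) x @ \oo --> y1 ->
  pseries (fun m => (t2 m)%:R) x @ \oo --> y2 ->
  pseries (fun m => (t3 m)%:R) x @ \oo --> y3 ->
  (map_poly intr (combination a ks t1 t2 t3 B)).[x] @[B --> \oo] -->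
  \sum_(k <- ks) (a k)%:~R * (y1 ^+ k.1.1 * y2 ^+ k.1.2 * y3 ^+ k.2).
Proof.
move=> h1 h2 h3.
have cvgX (u : nat -> R) (l : R) i : u @ \oo --> l -> u n ^+ i @[n --> \oo] --> l ^+ i.
  move=> ul; elim: i => [|i IH]; first by rewrite expr0; exact: cvg_cst.
  by rewrite exprS; under eq_fun do rewrite exprS; apply: cvgM.
elim: ks => [|k ks IH].
  rewrite big_nil; under eq_fun do rewrite /combination big_nil rmorph0 horner0.
  exact: cvg_cst.
rewrite big_cons.
have -> : (fun B => (map_poly intr (combination a (k :: ks) t1 t2 t3 B)).[x]) = fun B =>
    (a k)%:~R * (pseries (fun m => (t1 m)%:R) x B ^+ k.1.1 *
      pseries (fun m => (t2 m)%:R) x B ^+ k.1.2 * pseries (fun m => (t3 m)%:R) x B ^+ k.2) +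
    (map_poly intr (combination a ks t1 t2 t3 B)).[x].
  apply/funext => B; rewrite -!horner_trunc /combination big_cons rmorphD hornerD.
  rewrite rmorphM hornerM /= map_polyC hornerC /monomial.
  by rewrite !rmorphM /= !rmorphXn /= !hornerM !horner_exp.
apply: cvgD; last exact: IH.
apply: cvgM; first exact: cvg_cst.
by apply: cvgM; [apply: cvgM|]; exact: cvgX.
Qed.

(** * The leading monomial *)

Lemma coef_combination_eq0 (A C : set nat) t1 t2 t3 (d L B n : nat)
    (a : nat * nat * nat -> int) ks :
  (forall m, ~ A m -> t1 m = 0%N) -> (forall m, ~ A m -> t2 m = 0%N) ->
  (forall m, ~ C m -> t3 m = 0%N) ->
  (forall k, k \in ks -> (k.1.1 + k.1.2 <= d)%N /\ (k.2 <= L)%N) ->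
  ~ mixed_sums A C d L n -> (combination a ks t1 t2 t3 B)`_n = 0.
Proof.
move=> h1 h2 h3 hk nn; rewrite coef_combination big_seq big1 // => k /hk[k1 k2].
have [->|kn] := eqVneq (monomial t1 t2 t3 k B)`_n 0; first by rewrite mulr0.
by case: nn; apply: (mixed_sumsS k1 k2); exact: (@coefs_in_monomial A C _ _ _ k B h1 h2 h3 n kn).
Qed.

Lemma combination_value_neq0 (R : realType) (b : R) (w : nat -> R) (k : nat)
    (A C : set nat) (lA lC : nat -> nat) t1 t2 t3 (d e L : nat)
    (a : nat * nat * nat -> int) ks k0 (y1 y2 y3 : R) :
  pisot b \/ salem b -> weight w -> subexponential w k -> (0 < k)%N ->
  (forall n, (t1 n)%:R <= w n) -> (forall n, (t2 n)%:R <= w n) ->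
  (forall n, (t3 n)%:R <= w n) ->
  pseries (fun m => (t1 m)%:R) b^-1 @ \oo --> y1 ->
  pseries (fun m => (t2 m)%:R) b^-1 @ \oo --> y2 ->
  pseries (fun m => (t3 m)%:R) b^-1 @ \oo --> y3 ->
  (forall m, A m -> (0 < t1 m)%N) -> (forall m, A m -> (0 < t2 m)%N) ->
  (forall m, C m -> (0 < t3 m)%N) ->
  (forall m, ~ A m -> t1 m = 0%N) -> (forall m, ~ A m -> t2 m = 0%N) ->
  (forall m, ~ C m -> t3 m = 0%N) ->
  (forall T, exists M, forall m, M < m -> T * t2 m <= t1 m)%N ->
  counted A lA -> counted C lC -> {homo lA : x y / (x <= y)%N} ->
  {homo lC : x y / (x <= y)%N} -> eventually_le lA -> eventually_le lC ->
  unbounded lA -> unbounded lC ->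
  (exists N0, forall r, N0 <= r -> exists s : seq nat, [/\ size s = d.+1,
     {in s, forall x, A x}, sumn s < r &
     (r - sumn s) * (lA r ^ d * lC r ^ L.+1) < r])%N ->
  (exists K N1, 0 < K /\ forall r, N1 <= r -> exists2 l, C l & r <= l < K * r)%N ->
  (e < L)%N ->
  uniq ks -> k0 \in ks -> (k0.1.1 + k0.1.2 = d.+1)%N -> k0.2 = e.+1 -> 0 < a k0 ->
  (forall k, k \in ks -> [/\ (k.1.1 + k.1.2 <= d.+1)%N, (k.2 <= L)%N,
     ((k.1.1 + k.1.2)%N = d.+1 -> k.2 <= e.+1)%N &
     ((k.1.1 + k.1.2)%N = d.+1 -> k.2 = e.+1 -> k.1.1 <= k0.1.1)%N]) ->
  \sum_(k <- ks) (a k)%:~R * (y1 ^+ k.1.1 * y2 ^+ k.1.2 * y3 ^+ k.2) != 0.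
Proof.
move=> Hb hw sw kpos tw1 tw2 tw3 l1 l2 l3 p1 p2 p3 o1 o2 o3 dom cA cC mA mC sA sC uA uC
  c3 c1 eL uks k0s k0d k0e a0 hk; apply/negP => /eqP zero.
pose G := combination a ks t1 t2 t3.
(* Truncation at [n.+1] already determines the coefficient of index [n] in the full series. *)
pose c n := (G n.+1)`_n.
have Gc B n : (n < B)%N -> (G B)`_n = c n.
  move=> nB; rewrite /c /G !coef_combination; apply: eq_bigr => k' _; congr (_ * _).
  by apply: (@same_coefs_monomial _ _ _ _ n.+1).
have Glim : (map_poly intr (G B)).[b^-1] @[B --> \oo] --> (0 : R).
  by rewrite -zero; apply: cvg_combination.
have [N0 HN0] := partial_sum_before_gap Hb hw sw (tame_combination a ks hw tw1 tw2 tw3)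
  kpos Gc Glim.
pose T := (absz (\sum_(k <- ks) `|a k|)).+1.
have aT : \sum_(k <- ks) `|a k| < T%:Z.
  by rewrite /T -addn1 PoszD gez0_abs ?ltrDl // sumr_ge0.
have [M HM] := dom T.
have [x [m [y [u [v [g [[xN yg] [xu um mv vy] win gap [s1 [s2 [z1 z2 z3 z4 mE]]]]]]]]]] :=
  arbitrarily_large_windows M cA cC mA mC sA sC uA uC c3 c1 eL kpos N0.
have cgap n : (u <= n < u + g \/ v <= n < v + g)%N -> c n = 0.
  move=> /gap; apply: coef_combination_eq0 => // k' k's.
  by have [] := hk _ k's.
have b1 : 1 < b by case: Hb => -[].
have bi : 0 < b^-1 by rewrite invr_gt0 (lt_trans ltr01).
have powle n : (n <= y)%N -> (n ^ k.-1 <= g ^ k)%N.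
  by move=> ny; apply: leq_trans yg; apply: leq_expn.
have zu := HN0 u g ltac:(clear -xN xu; lia) (powle u ltac:(clear -xu um mv vy; lia))
  (fun n h => cgap n (or_introl h)).
have zv := HN0 v g ltac:(clear -xN xu um mv; lia) (powle v ltac:(clear -vy; lia))
  (fun n h => cgap n (or_intror h)).
have uv : (u <= m < v)%N by clear -um mv; lia.
have cpos n : (u <= n < v)%N ->
    (monomial t1 t2 t3 k0 n.+1)`_n <= T%:Z * c n.
  move=> nuv; apply: (@combination_window A C _ _ _ T M d e L x y) => //.
  by clear -nuv xu vy; lia.
have c_ge0 n : (u <= n < v)%N -> 0 <= c n.
  move=> /cpos; have := nneg_coefs_monomial t1 t2 t3 k0 n.+1 n.
  by move=> h1 /(le_trans h1); rewrite pmulr_rge0.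
have cm : 0 < c m.
  have := cpos m uv; have := @coef_monomial_gt0 A C t1 t2 t3 k0 m.+1 s1 s2 p1 p2 p3.
  rewrite z1 z2 k0d k0e -mE => /(_ erefl erefl z3 z4 (leqnn _)) h1 /(lt_le_trans h1).
  by rewrite pmulr_rgt0.
(* Both partial sums vanish, so the terms from [u] to [v] add up to 0; yet they are nonnegative, and
   the one at [m], split off below, is positive. *)
have : \sum_(0 <= n < v) (c n)%:~R * b^-1 ^+ n = 0 :> R by rewrite big_mkord.
have uv' : (u <= v)%N by clear -uv; lia.
rewrite (@big_cat_nat _ _ _ u) //= big_mkord zu add0r => /eqP; rewrite gt_eqF //.
have [um' mv'] := andP uv.
rewrite (@big_cat_nat _ _ _ m) ?(ltnW mv') //= [\sum_(m <= _ < v) _]big_ltn //.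
have nn i j : (u <= i)%N -> (j <= v)%N ->
    0 <= \sum_(i <= n < j) (c n)%:~R * b^-1 ^+ n :> R.
  move=> ui jv; rewrite big_nat; apply: sumr_ge0 => n /andP[ni nj].
  apply: mulr_ge0; last exact/exprn_ge0/ltW.
  by rewrite ler0z c_ge0 // (leq_trans ui) //= (leq_trans nj).
rewrite ltr_wpDl ?nn // ?(ltnW mv') // ltr_pwDl ?nn //; last exact: leqW.
by apply: mulr_gt0; [rewrite ltr0z|apply: exprn_gt0].
Qed.

(** * Reading off the hypotheses *)

Lemma lt_bound_nat (R : realType) (x : R) N : ((Num.bound `|x|).+1 <= N)%N -> x < N%:R.
Proof.
move=> xN; apply: le_lt_trans (ler_norm x) _.
apply: (lt_trans (archi_boundP (normr_ge0 x))).
by rewrite ltr_nat.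
Qed.

Lemma finite_below (R : realType) (S : set nat) (r : R) : finite_set (below S r).
Proof.
apply: (@sub_finite_set _ _ `I_(Num.bound r)); last exact: finite_II.
move=> n [_ /= nr]; have [r0|r0] := leP 0 r.
  by rewrite -(ltr_nat R) (lt_trans nr) // archi_boundP.
by have := lt_trans nr r0; rewrite ltrn0.
Qed.

Lemma mem_below (R : realType) (S : set nat) (r : R) n :
  (n \in fset_set (below S r)) <-> (S n /\ n%:R < r).
Proof.
rewrite in_fset_set; last exact: finite_below.
by rewrite in_setE.
Qed.

Lemma counted_lambda (R : realType) (S : set nat) :
  counted S (fun N => lambda S (N%:R : R)).
Proof.
move=> N; exists (fset_set (below S (N%:R : R))) => // n nN Sn.
by apply/mem_below; rewrite ltr_nat.
Qed.

Lemma le_lambda (R : realType) (S : set nat) (r r' : R) :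
  r <= r' -> (lambda S r <= lambda S r')%N.
Proof.
move=> rr; apply: fsubset_leq_card; apply/fsubsetP => n /mem_below[Sn nr].
by apply/mem_below; split=> //; apply: lt_le_trans rr.
Qed.

Lemma unbounded_lambda (R : realType) (S : set nat) : infinite_set S ->
  unbounded (fun N => lambda S (N%:R : R)).
Proof.
move=> Si K.
have [s [su sK Ss]] : exists s : seq nat, [/\ uniq s, size s = K & {in s, forall x, S x}].
  elim: K => [|K [s [su sK Ss]]]; first by exists [::].
  have [x xS xs] : exists2 x, S x & x \notin s.
    apply: contrapT => H; apply: Si; apply: (@sub_finite_set _ _ [set` s]).
      move=> x Sx /=; apply: contrapT => /negP xs; by apply: H; exists x.
    exact: finite_seq.
  exists (x :: s); rewrite /= xs su sK; split=> // y.
  by rewrite inE => /orP[/eqP->|/Ss].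
exists (\max_(x <- s) x).+1 => N sN.
rewrite -sK /lambda; apply: uniq_leq_size => // x xs.
apply/mem_below; split; first exact: Ss.
by rewrite ltr_nat; apply: leq_trans sN; rewrite ltnS (big_rem x) //= leq_maxl.
Qed.

Lemma eventually_le_lambda (R : realType) (S : set nat) :
  (forall eps : R, 0 < eps ->
    (fun r : R => (lambda S r)%:R : R) =o_ (+oo_R) (fun r : R => r `^ eps)) ->
  eventually_le (fun N => lambda S (N%:R : R)).
Proof.
move=> H K.
(* The exponent [1 / (K + 1)] is positive also for [K = 0]. *)
have [|r0 [_ Hr]] := (eqoP _ _ _).1 (H K.+1%:R^-1 _) 1 ltr01.
  by rewrite invr_gt0.
exists (Num.bound `|r0|).+1 => N Nr.
have rN := lt_bound_nat Nr.
have := Hr _ rN; rewrite mul1r !ger0_norm ?powR_ge0 // => lN.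
have K0 : K.+1%:R != 0 :> R by rewrite pnatr_eq0.
have : (lambda S (N%:R : R) ^ K.+1 <= N)%N.
  rewrite -(ler_nat R) natrX; apply: (@le_trans _ _ ((N%:R `^ K.+1%:R^-1) ^+ K.+1)).
    by rewrite lerXn2r // nnegrE ?powR_ge0.
  by rewrite -powR_mulrn ?powR_ge0 // -powRrM (mulVf K0) powRr1.
have [l0 _|l0] := posnP (lambda S (N%:R : R)).
  by rewrite l0; apply: leq_trans (leq_trans _ Nr) => //; case: (K) => // i; rewrite exp0n.
by apply: leq_trans; rewrite expnS leq_pmull.
Qed.

Lemma mem_nfold_sumset (k : nat) (A : set nat) n : nfold_sumset k A n ->
  exists s : seq nat, [/\ size s = k, {in s, forall x, A x} & n = sumn s].
Proof.
elim: k n => [|k IH] n; first by move=> ->; exists [::].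
case: k IH => [|k] IH.
  by move=> An; exists [:: n]; split=> //= [x|]; rewrite ?addn0 // inE => /eqP->.
move=> [x Ax [y yA <-]]; have [s [sk sA ->]] := IH _ yA.
exists (x :: s); split=> //=; first by rewrite sk.
by move=> z; rewrite inE => /orP[/eqP->|/sA].
Qed.

Lemma bigmaxn_mem (s : seq nat) n : n \in s -> (\max_(x <- s) x)%N \in s.
Proof.
elim: s n => // x s IH n _; rewrite big_cons.
case: s IH => [|y s] IH; first by rewrite big_nil maxn0 mem_head.
rewrite {1}/maxn; case: ifP => _; last by rewrite mem_head.
by rewrite inE (IH y) ?orbT // mem_head.
Qed.

Lemma mem_theta (R : realType) (A : set nat) (r : R) : below A r !=set0 ->
  below A r (theta A r).
Proof.
move=> [n nA].
suff /mem_below : theta A r \in fset_set (below A r) by [].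
by apply: (@bigmaxn_mem _ n); apply/mem_below.
Qed.

(** Nonemptiness makes [theta] an actual maximum, hence a sum of [a1.+1] elements, and positivity of
    the product of counts allows the quotient to be cleared. *)
Lemma dense_sums (R : realType) (S1 S2 : set nat) (a1 a2 : nat) :
  (exists2 C2 : R, 0 < C2 &
     forall r : R, C2 <= r ->
       [/\ below (nfold_sumset (1 + a1) S1) r !=set0,
           (0 < lambda S1 r ^ a1 * lambda S2 r ^ a2)%N &
           r - (theta (nfold_sumset (1 + a1) S1) r)%:R
             < r / ((lambda S1 r)%:R ^+ a1 * (lambda S2 r)%:R ^+ a2)]) ->
  exists N0, forall r, (N0 <= r)%N -> exists s : seq nat, [/\ size s = a1.+1,
     {in s, forall x, S1 x}, (sumn s < r)%N &
     ((r - sumn s) * (lambda S1 (r%:R : R) ^ a1 * lambda S2 (r%:R : R) ^ a2) < r)%N].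
Proof.
move=> [C2 C20 H]; exists (Num.bound C2) => r rC.
have /H[ne l0 lt] : C2 <= r%:R.
  by apply/ltW/(lt_le_trans (archi_boundP (ltW C20))); rewrite ler_nat.
have [/mem_nfold_sumset[s [sk sA sE]] /= sr] := mem_theta ne.
rewrite sE ltr_nat in sr; exists s; split=> //.
move: lt l0; rewrite sE -natrB ?(ltnW sr) //.
have -> : (lambda S1 (r%:R : R))%:R ^+ a1 * (lambda S2 (r%:R : R))%:R ^+ a2 =
    (lambda S1 (r%:R : R) ^ a1 * lambda S2 (r%:R : R) ^ a2)%:R :> R.
  by rewrite natrM !natrX.
by move: (_ * _)%N => P + P0; rewrite ltr_pdivlMr ?ltr0n // -natrM ltr_nat.
Qed.

Lemma bounded_ratio (R : realType) (S2 : set nat) (C1 : R) :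
  (\forall r \near +oo_R, [set n | r <= n%:R < C1 * r] `&` S2 !=set0) ->
  exists K N1, (0 < K)%N /\
    forall r, (N1 <= r)%N -> exists2 l, S2 l & (r <= l < K * r)%N.
Proof.
move=> [r0 [_ H]]; exists (Num.bound `|C1|).+1, (Num.bound `|r0|).+1; split=> // r rr.
have rN := lt_bound_nat rr.
have [l [/= /andP[rl lr] Sl]] := H _ rN; exists l => //.
rewrite -!(ltr_nat R) -(ler_nat R) rl /= (lt_le_trans lr) // natrM ler_wpM2r //.
exact/ltW/lt_bound_nat.
Qed.

Lemma eventually_dominates (R : realType) (S : set nat) (t1 t2 : nat -> nat) :
  (forall m, S m -> (0 < t2 m)%N) -> (forall m, ~ S m -> t2 m = 0%N) ->
  ((t1 n)%:R / (t2 n)%:R : R) @[n --> within S \oo] --> +oo_R ->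
  forall T, exists M, forall m, (M < m)%N -> (T * t2 m <= t1 m)%N.
Proof.
move=> t2S t20 /cvgryPge H T; have [M _ HM] := H T%:R.
exists M => m Mm; have [Sm|Sm] := pselect (S m); last by rewrite t20 // muln0.
have := HM m (ltnW Mm) Sm; rewrite ler_pdivlMr ?ltr0n ?t2S //.
by rewrite -natrM ler_nat.
Qed.

(** * Reduction to integer combinations of monomials *)

Lemma exists_max (T : eqType) (s : seq T) (f : T -> nat) x : x \in s ->
  exists2 x0, x0 \in s & {in s, forall y, f y <= f x0}%N.
Proof.
elim: s x => // y s IH x _.
case: s IH => [|z s] IH.
  by exists y; rewrite ?mem_head // => u; rewrite inE => /eqP->.
have [x0 xs x0m] := IH z (mem_head _ _).
have [h|h] := leqP (f y) (f x0).
  exists x0; first by rewrite inE xs orbT.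
  by move=> u; rewrite inE => /orP[/eqP->|/x0m].
exists y; first exact: mem_head.
by move=> u; rewrite inE => /orP[/eqP->|/x0m /leq_trans]; [|apply; apply: ltnW].
Qed.

(** Three maximizations over nested sublists: joint degree, then third exponent, then first
    exponent. [L] is the largest third exponent in all of [ks], since monomials of lower joint
    degree may exceed [e.+1] there. *)
Lemma leading_monomial (ks : seq (nat * nat * nat)) k : k \in ks ->
  {in ks, forall k, 0 < k.1.1 /\ 0 < k.2}%N ->
  exists k0 d e L, [/\ k0 \in ks, (k0.1.1 + k0.1.2 = d.+1)%N, k0.2 = e.+1, (e < L)%N &
  {in ks, forall k, [/\ (k.1.1 + k.1.2 <= d.+1)%N, (k.2 <= L)%N,
     ((k.1.1 + k.1.2)%N = d.+1 -> k.2 <= e.+1)%N &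
     ((k.1.1 + k.1.2)%N = d.+1 -> k.2 = e.+1 -> k.1.1 <= k0.1.1)%N]}].
Proof.
move=> kks pos.
have [kL _ HL] := exists_max (fun k => k.2) kks.
have [k1 k1s H1] := exists_max (fun k => k.1.1 + k.1.2)%N kks.
have k1f : k1 \in [seq k <- ks | k.1.1 + k.1.2 == k1.1.1 + k1.1.2]%N.
  by rewrite mem_filter eqxx.
have [k2] := exists_max (fun k => k.2) k1f.
rewrite mem_filter => /andP[/eqP k2d k2s] H2.
have k2f : k2 \in [seq k <- ks | (k.1.1 + k.1.2 == k1.1.1 + k1.1.2)%N && (k.2 == k2.2)].
  by rewrite mem_filter k2d !eqxx.
have [k0] := exists_max (fun k => k.1.1) k2f.
rewrite mem_filter => /andP[/andP[/eqP k0d /eqP k0e] k0s] H0.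
have [p1 p2] := pos _ k0s.
exists k0, (k0.1.1 + k0.1.2).-1, k0.2.-1, kL.2.
have dE : (k0.1.1 + k0.1.2).-1.+1 = (k1.1.1 + k1.1.2)%N by rewrite prednK // addn_gt0 p1.
have eE : k0.2.-1.+1 = k2.2 by rewrite prednK.
rewrite dE eE; split => //; first exact: HL.
move=> k' k's; split => //.
- exact: H1.
- exact: HL.
- by move=> k'd; apply: H2; rewrite mem_filter k'd eqxx.
- by move=> k'd k'e; apply: H0; rewrite mem_filter k'd k'e !eqxx.
Qed.

Lemma clear_denominators (T : eqType) (s : seq T) (a : T -> rat) :
  exists (D : int) (z : T -> int), 0 < D /\
    {in s, forall x, (z x)%:~R = D%:~R * a x}.
Proof.
suff [D D0 H] : exists2 D : int, 0 < D & {in s, forall x, D%:~R * a x \is a Num.int}.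
  exists D, (fun x => numq (D%:~R * a x)); split=> // x xs.
  by rewrite numqK // H.
elim: s => [|y s [D D0 H]]; first by exists 1.
exists (D * denq (a y)); first by rewrite mulr_gt0 // denq_gt0.
move=> x; rewrite inE => /orP[/eqP->|xs]; rewrite intrM.
  by rewrite -mulrA [_%:~R * a y]mulrC -numqE rpredM // intr_int.
by rewrite mulrAC rpredM ?H // intr_int.
Qed.

(** Multi-indices of the support are encoded injectively as triples, and clearing denominators
    leaves nonzero integer coefficients. *)
Lemma alg_independent3 (R : realType) (y1 y2 y3 : R) :
  (forall (ks : seq (nat * nat * nat)) (a : nat * nat * nat -> int), uniq ks ->
     ks != [::] -> {in ks, forall k, a k != 0} ->
     \sum_(k <- ks) (a k)%:~R * (y1 ^+ k.1.1 * y2 ^+ k.1.2 * y3 ^+ k.2) != 0) ->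
  alg_independent (tnth [tuple y1; y2; y3]).
Proof.
move=> H p p0; apply/negP => /eqP pz.
pose kap (m : mpoly.multinom 3) := (m ord0, m (inord 1), m (inord 2)) : nat * nat * nat.
have i1 : inord 1 = lift ord0 ord0 :> 'I_3 by apply/val_inj; rewrite /= inordK.
have i2 : inord 2 = lift ord0 (lift ord0 ord0) :> 'I_3 by apply/val_inj; rewrite /= inordK.
have kap_inj : injective kap.
  move=> m m' [e0 e1 e2]; apply/mpoly.mnmP => i.
  have : i \in [:: ord0; inord 1; inord 2].
    by rewrite !inE -!val_eqE /= !inordK //; case: i => -[|[|[|]]].
  by rewrite !inE => /or3P[] /eqP->.
have evE : \sum_(m <- mpoly.msupp p) ratr (mpoly.mcoeff m p) *
    (y1 ^+ (kap m).1.1 * y2 ^+ (kap m).1.2 * y3 ^+ (kap m).2) = 0 :> R.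
  rewrite -[RHS]pz /mpoly.map_mpoly /mpoly.mmap raddf_sum.
  apply: eq_bigr => m _ /=; rewrite mpoly.mevalM mpoly.mevalC mpoly.mmap1_id mpoly.mevalX.
  congr (_ * _); rewrite !big_ord_recl big_ord0 mulr1 mulrA /kap /= i1 i2.
  by rewrite !(tnth_nth 0).
have [D [z [D0 zE]]] := clear_denominators (mpoly.msupp p) (fun m => mpoly.mcoeff m p).
pose inv (k : nat * nat * nat) : mpoly.multinom 3 :=
  mpoly.Multinom [tuple k.1.1; k.1.2; k.2].
have invK m : inv (kap m) = m.
  apply: kap_inj; rewrite /kap /inv /= !mpoly.mnm_tnth i1 i2 /=.
  by rewrite !(tnth_nth 0%N).
have uks : uniq [seq kap m | m <- mpoly.msupp p].
  by rewrite map_inj_uniq // mpoly.msupp_uniq.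
have nks : [seq kap m | m <- mpoly.msupp p] != [::].
  by rewrite -size_eq0 size_map size_eq0 mpoly.msupp_eq0.
have nz : {in [seq kap m | m <- mpoly.msupp p], forall k, (z \o inv) k != 0}.
  move=> _ /mapP[m ms ->] /=; rewrite invK -(intr_eq0 rat) zE // mulf_neq0 //.
    by rewrite intr_eq0 gt_eqF.
  by rewrite -mpoly.mcoeff_msupp.
have /eqP := H _ _ uks nks nz; apply.
rewrite big_map /=.
transitivity (D%:~R * (0 : R)); last by rewrite mulr0.
rewrite -[X in _ = _ * X]evE mulr_sumr big_seq [RHS]big_seq; apply: eq_bigr => m ms.
have zm : (z m)%:~R = D%:~R * ratr (mpoly.mcoeff m p) :> R.
  by rewrite -(ratr_int _ (z m)) zE // rmorphM /= ratr_int.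
by rewrite invK zm -!mulrA.
Qed.

Theorem theorem2 (R : realType) (S1 S2 : set nat) (t1 t2 t3 : nat -> nat)
  (S1_inf : infinite_set S1) (S2_inf : infinite_set S2)
  (t1_pos : forall m, S1 m -> (0 < t1 m)%N)
  (t2_pos : forall m, S1 m -> (0 < t2 m)%N)
  (t3_pos : forall m, S2 m -> (0 < t3 m)%N)
  (t1_out : forall m, ~ S1 m -> t1 m = 0%N)
  (t2_out : forall m, ~ S1 m -> t2 m = 0%N)
  (t3_out : forall m, ~ S2 m -> t3 m = 0%N)
  (cond1 : exists2 C1 : R, 1 < C1 &
     \forall r \near +oo_R,
       [set n | r <= n%:R < C1 * r] `&` S2 !=set0)
  (cond2 : forall eps : R, 0 < eps ->
     (fun r : R => (lambda S1 r)%:R : R) =o_ (+oo_R) (fun r : R => r `^ eps) /\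
     (fun r : R => (lambda S2 r)%:R : R) =o_ (+oo_R) (fun r : R => r `^ eps))
  (cond3 : forall a1 a2 : nat, exists2 C2 : R, 0 < C2 &
     forall r : R, C2 <= r ->
       [/\ below (nfold_sumset (1 + a1) S1) r !=set0,
           (0 < lambda S1 r ^ a1 * lambda S2 r ^ a2)%N &
           r - (theta (nfold_sumset (1 + a1) S1) r)%:R
             < r / ((lambda S1 r)%:R ^+ a1 * (lambda S2 r)%:R ^+ a2)])
  (cond4 : exists2 C3 : R, 0 < C3 < 1 &
     [/\ (fun n => logplus (t1 n)%:R) =o_\oo (fun n => n%:R `^ (1 - C3)),
         (fun n => logplus (t2 n)%:R) =o_\oo (fun n => n%:R `^ (1 - C3)) &
         (fun n => logplus (t3 n)%:R) =o_\oo (fun n => n%:R `^ (1 - C3))])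
  (cond5 : (t1 n)%:R / (t2 n)%:R @[n --> within S1 \oo] --> +oo_R) :
  forall b : R, pisot b \/ salem b ->
    alg_independent
      (tnth [tuple psum_value t1 b^-1; psum_value t2 b^-1; psum_value t3 b^-1]).
Proof.
move=> b Hb; apply: alg_independent3 => ks a uks ks0 a0.
have b1 : 1 < b by case: Hb => -[].
have [C3 /andP[C30 C31] [log1 log2 log3]] := cond4.
have p0 : 0 < 1 - C3 by rewrite subr_gt0.
have [K1 K10 d1] := exp_weight_dominates (ltW p0) log1.
have [K2 K20 d2] := exp_weight_dominates (ltW p0) log2.
have [K3 K30 d3] := exp_weight_dominates (ltW p0) log3.
pose K := (1 - C3)^-1 + K1 + K2 + K3.
have pK : 0 <= (1 - C3)^-1 by rewrite invr_ge0 ltW.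
have hw : weight (exp_weight K (1 - C3)) by apply: weight_exp => //; rewrite /K; lra.
(* Then [1 / k < C3], so a gap of length [N ^ (1 - 1 / k)] outweighs coefficients of size
   [exp (n ^ (1 - C3))]. *)
pose k := (Num.bound `|C3^-1|).+1.
have sw : subexponential (exp_weight K (1 - C3)) k.
  apply: subexponential_exp => //; first by rewrite /K; lra.
  rewrite opprB addrC subrK invf_plt ?posrE ?ltr0n //.
  exact: lt_bound_nat.
have tw1 n : (t1 n)%:R <= exp_weight K (1 - C3) n by apply: d1; rewrite /K; lra.
have tw2 n : (t2 n)%:R <= exp_weight K (1 - C3) n by apply: d2; rewrite /K; lra.
have tw3 n : (t3 n)%:R <= exp_weight K (1 - C3) n by apply: d3; rewrite /K; lra.
have dom := eventually_dominates t2_pos t2_out cond5.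
have [C1 _ /bounded_ratio c1] := cond1.
have e1 : eventually_le (fun N => lambda S1 (N%:R : R)).
  by apply: eventually_le_lambda => eps /cond2[].
have e2 : eventually_le (fun N => lambda S2 (N%:R : R)).
  by apply: eventually_le_lambda => eps /cond2[].
have m1 : {homo (fun N => lambda S1 (N%:R : R)) : x y / (x <= y)%N}.
  by move=> x y xy; apply: le_lambda; rewrite ler_nat.
have m2 : {homo (fun N => lambda S2 (N%:R : R)) : x y / (x <= y)%N}.
  by move=> x y xy; apply: le_lambda; rewrite ler_nat.
(* Multiplying the relation by [y1 * y3] makes the first and third exponents positive, as the forms
   [d.+1] and [e.+1] require. *)
pose sh (k : nat * nat * nat) := (k.1.1.+1, k.1.2, k.2.+1).
pose unsh (k : nat * nat * nat) := (k.1.1.-1, k.1.2, k.2.-1).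
have shK : cancel sh unsh by move=> [[]].
have [k1 k1s] : exists k1, k1 \in map sh ks.
  by case: ks {uks a0} ks0 => // k1 s _; exists (sh k1); rewrite mem_head.
have [|k0 [d [e [L [k0s k0d k0e eL H]]]]] := leading_monomial k1s.
  by move=> _ /mapP[k' _ ->].
(* This factor turns the leading coefficient into a nonzero square, hence makes it positive. *)
pose a' k := a (unsh k0) * a (unsh k).
have := @combination_value_neq0 R b _ k S1 S2 _ _ t1 t2 t3 d e L a' (map sh ks) k0
  (psum_value t1 b^-1) (psum_value t2 b^-1) (psum_value t3 b^-1) Hb hw sw isT tw1 tw2 tw3
  (is_cvg_psum sw isT tw1 b1) (is_cvg_psum sw isT tw2 b1) (is_cvg_psum sw isT tw3 b1)
  t1_pos t2_pos t3_pos t1_out t2_out t3_out dom (counted_lambda R S1) (counted_lambda R S2)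
  m1 m2 e1 e2 (unbounded_lambda R S1_inf) (unbounded_lambda R S2_inf)
  (dense_sums (cond3 d L.+1)) c1 eL.
rewrite map_inj_uniq; last exact: can_inj shK.
have a'0 : 0 < a' k0.
  rewrite /a' lt0r mulf_neq0 -?expr2 ?sqr_ge0 //; case/mapP: k0s => k' k's ->;
  by rewrite shK a0.
move=> /(_ uks k0s k0d k0e a'0 H); apply: contraNneq => sum0.
apply/eqP; rewrite big_map.
set y1 := psum_value t1 _; set y2 := psum_value t2 _; set y3 := psum_value t3 _.
transitivity ((a (unsh k0))%:~R * (y1 * y3) *
    (\sum_(k <- ks) (a k)%:~R * (y1 ^+ k.1.1 * y2 ^+ k.1.2 * y3 ^+ k.2))).
  rewrite mulr_sumr; apply: eq_bigr => k' _; rewrite /a' shK intrM /= !exprS; ring.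
by rewrite sum0 mulr0.
Qed.
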